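(* Let $\mathsf{T}$ be a p-string of length $n$ over $\Sigma_s \cup \Sigma_p$ with $\mathsf{T}[n] = \$$, and let $\mathsf{L}$ be the pBWT of $\mathsf{T}$. Given $\mathsf{L}$ only, one can compute in $O(n^3)$ time and $O(n^2)$ space a p-string that p-matches $\mathsf{T}$.
   Context: Let $\Sigma_s$ (static symbols) and $\Sigma_p$ (parameter symbols) be disjoint finite ordered alphabets. $\Sigma_s$ is disjoint from the integers, and every s-symbol is smaller than every integer. A p-string is a string over $\Sigma_s\cup\Sigma_p$. Two p-strings $x,y$ p-match if $y$ is obtained from $x$ by applying a bijection of $\Sigma_p$ to every occurrence of a p-symbol in $x$ (s-symbols are unchanged). The prev-encoding $\langle w\rangle$ of a p-string $w$ of length $m$ is the string of length $m$ with $\langle w\rangle[i]=w[i]$ if $w[i]\in\Sigma_s$; $\langle w\rangle[i]=0$ if $w[i]\in\Sigma_p$ does not occur in $w[1..i-1]$; and $\langle w\rangle[i]=i-j$ otherwise, where $j$ is the largest position in $[1..i-1]$ with $w[j]=w[i]$. Write $\mathrm{zeros}(X)$ for the number of occurrences of $0$ in $X$. Strings are compared lexicographically, with a proper prefix smaller than any extension. $\mathsf{T}$ is a p-string of length $n$ with $\mathsf{T}[n]=\$$, where $\$$ is the smallest s-symbol and does not occur elsewhere in $\mathsf{T}$. For an integer $i$, $\mathsf{T}_i=\mathsf{T}[i'..n]\mathsf{T}[1..i'-1]$, where $i'\in[1..n]$ and $i'\equiv i \pmod n$. Let $\tau$ be the permutation of $[1..n]$ such that $\langle \mathsf{T}_{\tau[i]}\rangle$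 is the $i$-th lexicographically smallest string among $\{\langle \mathsf{T}_{i'}\rangle\}_{i'=1}^n$. The pBWT of $\mathsf{T}$ is the string $\mathsf{L}$ of length $n$ defined by: - $\mathsf{L}[i]=\mathsf{T}_{\tau[i]}[n]$ if $\mathsf{T}_{\tau[i]}[n]\in\Sigma_s$; - otherwise $\mathsf{L}[i]=\mathrm{zeros}(\langle \mathsf{T}_{\tau[i]}[1..j]\rangle)$, where $j$ is the smallest position with $\mathsf{T}_{\tau[i]}[j]=\mathsf{T}_{\tau[i]}[n]$. Time is measured on a word RAM, and space in machine words. *)

(* Defs.v *)
(* Positions are 0-based throughout: the position i of the
   mathematical text is the index i - 1 here. *)
From HB Require Import structures.
From mathcomp Require Import all_boot all_order.

Set Implicit Arguments.
Unset Strict Implicit.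
Unset Printing Implicit Defensive.

Section PStrings.
Variables (ds dp : Order.disp_t) (Ss : finOrderType ds) (Sp : finOrderType dp).

Definition psym : Type := (Ss + Sp)%type.

(* The alphabet of prev-encodings and of the pBWT: s-symbols and integers. *)
Definition ecode : Type := (Ss + nat)%type.

Definition psubst (f : Sp -> Sp) (c : psym) : psym :=
  match c with inl s => inl s | inr p => inr (f p) end.

Definition pmatch (x y : seq psym) : Prop :=
  exists2 f : Sp -> Sp, bijective f & y = map (psubst f) x.

Definition prev_sym (w : seq psym) (i : nat) (c : psym) : ecode :=
  match c with
  | inl s => inl s
  | inr _ => if c \in take i w
             then inr (i - \max_(j < i | nth c w j == c) (j : nat))
             else inr 0
  end.

Definition prev_enc (w : seq psym) : seq ecode :=
  [seq prev_sym w i (tnth (in_tuple w) i) | i : 'I_(size w)].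

Definition zeros (X : seq ecode) : nat := count_mem (inr 0) X.

Definition ecode_lt (x y : ecode) : bool :=
  match x, y with
  | inl a, inl b => (a < b)%O
  | inl _, inr _ => true
  | inr _, inl _ => false
  | inr k, inr l => k < l
  end.

Fixpoint lex_le (X Y : seq ecode) : bool :=
  match X, Y with
  | [::], _ => true
  | _ :: _, [::] => false
  | x :: X', y :: Y' => ecode_lt x y || (x == y) && lex_le X' Y'
  end.

(* [rot i T] is the rotation T_{i+1}; the list below is tau, with its entries
   shifted by one. *)
Definition rot_order (T : seq psym) : seq nat :=
  sort (fun i j => lex_le (prev_enc (rot i T)) (prev_enc (rot j T)))
       (iota 0 (size T)).

Definition pbwt_sym (w : seq psym) (c : psym) : ecode :=
  match c with
  | inl s => inl s
  | inr _ => inr (zeros (prev_enc (take (index c w).+1 w)))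
  end.

(* [last x w] is the last symbol of w; the default x is irrelevant because the
   rotations of T are nonempty whenever [rot_order T] is. *)
Definition pbwt (x : psym) (T : seq psym) : seq ecode :=
  [seq (let w := rot i T in pbwt_sym w (last x w)) | i <- rot_order T].

End PStrings.

Arguments psym {ds dp} Ss Sp.
Arguments ecode {ds} Ss.

(* Word RAM with w-bit words. A program is a fixed finite list of unit-cost
   instructions, chosen independently of w; it halts when the program counter
   leaves the list. Registers are unboundedly indexed, but a given program
   mentions only finitely many of them. *)

Inductive binop : Type :=
  | OAdd | OSub | OMul | ODiv | OMod
  | OAnd | OOr | OXor | OShl | OShr | OLt | OEq.

Inductive instr : Type :=
  | IConst (r c : nat)                  (* r := c *)
  | IOp (o : binop) (r a b : nat)       (* r := a o b *)
  | ILoad (r a : nat)                   (* r := M[a] *)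
  | IStore (a r : nat)                  (* M[a] := r *)
  | IJz (r l : nat).                    (* if r = 0 goto l *)

Record state : Type := State { pc : nat; regs : nat -> nat; memory : nat -> nat }.

Definition upd (f : nat -> nat) (a v : nat) : nat -> nat :=
  fun x => if x == a then v else f x.

Definition eval_op (w : nat) (o : binop) (x y : nat) : nat :=
  match o with
  | OAdd => x + y
  | OSub => x + (2 ^ w - y)
  | OMul => x * y
  | ODiv => x %/ y
  | OMod => x %% y
  | OAnd => Nat.land x y
  | OOr => Nat.lor x y
  | OXor => Nat.lxor x y
  | OShl => x * 2 ^ y
  | OShr => x %/ 2 ^ y
  | OLt => x < y
  | OEq => x == y
  end %% 2 ^ w.

Definition exec (w : nat) (i : instr) (st : state) : state :=
  let: State p R M := st in
  match i with
  | IConst r c => State p.+1 (upd R r (c %% 2 ^ w)) M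
  | IOp o r a b => State p.+1 (upd R r (eval_op w o (R a) (R b))) M
  | ILoad r a => State p.+1 (upd R r (M (R a))) M
  | IStore a r => State p.+1 R (upd M (R a) (R r))
  | IJz r l => State (if R r == 0 then l else p.+1) R M
  end.

Definition halted (P : seq instr) (st : state) : bool := size P <= pc st.

Definition step (w : nat) (P : seq instr) (st : state) : state :=
  if onth P (pc st) is Some i then exec w i st else st.

Definition run (w : nat) (P : seq instr) (t : nat) (st : state) : state :=
  iter t (step w P) st.

Definition accessed (P : seq instr) (st : state) : option nat :=
  match onth P (pc st) with
  | Some (ILoad _ a) => Some (regs st a)
  | Some (IStore a _) => Some (regs st a)
  | _ => None
  end.

(* P, started in st, halts within [time] steps in a state satisfying Q, and only
   ever accesses the memory cells 0, ..., space - 1. *)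
Definition runs_within (w : nat) (P : seq instr) (time space : nat)
    (st : state) (Q : state -> Prop) : Prop :=
  exists t : nat,
    [/\ t <= time,
        halted P (run w P t st),
        forall u a, u < t -> accessed P (run w P u st) = Some a -> a < space
      & Q (run w P t st)].

Section Encoding.
Variables (ds dp : Order.disp_t) (Ss : finOrderType ds) (Sp : finOrderType dp).

(* Each symbol takes two words, a tag and a value. An s-symbol or p-symbol is
   represented by its rank in its alphabet, an integer by itself. *)
Definition words (A : Type) (code : A -> nat) (X : seq (Ss + A)) : seq nat :=
  flatten [seq match x with
               | inl s => [:: 0; Order.enum_rank s : nat]
               | inr a => [:: 1; code a]
               end | x <- X].

Definition ewords (X : seq (ecode Ss)) : seq nat := words id X.

Definition pwords (X : seq (psym Ss Sp)) : seq nat :=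
  words (fun p : Sp => Order.enum_rank p : nat) X.

(* The length of the input is in register 0 and the input itself is in memory
   from address 0 on; everything else is 0. *)
Definition init (X : seq (ecode Ss)) : state :=
  State 0 (fun r => if r == 0 then size X else 0) (nth 0 (ewords X)).

(* The output is written from address 0 on. *)
Definition outputs (X : seq (psym Ss Sp)) (st : state) : Prop :=
  mkseq (memory st) (size (pwords X)) = pwords X.

End Encoding.

(* Main.v *)
Require Import Defs.
From HB Require Import structures.
From mathcomp Require Import all_boot all_order.
From mathcomp Require Import zify.

(** Inversion by repeated prepending and sorting. Suppose the first [k] columns
    of the sorted list of prev-encoded rotations are known. Prepending to row
    [i] the symbol described by [L[i]] gives the first [k + 1] symbols of a
    prev-encoded rotation again: a p-symbol adds a leading [0] and replaces the
    [L[i]]-th [0] of the row, if it has been read, by its distance to the front.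
    Every rotation is obtained this way, so sorting the new rows gives the first
    [k + 1] columns. After [n] rounds the row with [L[i] = $] is the prev-encoding
    of [T], from which a p-matching string is read off.

    A round takes quadratic time because the lengths of the longest common
    prefixes of all pairs of rows are maintained: prepending changes each row
    in one place, so the new relative order and the new common prefix of two
    rows are computed in constant time from the old ones and the two places.

    The algorithm is written in a small language of array comprehensions and
    bounded sums, which is compiled to the word RAM. *)

Set Implicit Arguments.
Unset Strict Implicit.
Unset Printing Implicit Defensive.

Import Order.TTheory.

(** * Array programs and their compilation *)

(** A repetition in column q carries a distance of at most q, while the new distance of a bumped
    entry to the front is q + 1: it exceeds whatever any row can have in that column. Bumping thus
    only raises a row. Two rows trade places only if the earlier one is bumped within their common
    prefix or at its end, before the other's pivot; and the earlier of two different pivots always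
    bounds the new common prefix. The pivot is found from L alone, by counting the columns with
    fewer zeros than L[i]; a static symbol gets the unreachable count n + 1, so its row is never
    bumped. Rows that still agree must get different places, so ties are broken by the old index.
    The row placed at rank a then need not come from the rotation preceding row a; only its first k
    + 1 columns are claimed to be right, by uniqueness of sorted lists. Sorting is done by counting
    predecessors, and the permutation is inverted by a weighted sum, as sums are the only search in
    the array language; both are quadratic per round. The names of p-symbols are lost; numbering
    them by first occurrence is a bijection of the alphabet. *)

Inductive arith := AAdd | ASub | AMul | ALt | AEq.

Definition arith_op (o : arith) : binop :=
  match o with AAdd => OAdd | ASub => OSub | AMul => OMul | ALt => OLt | AEq => OEq end.

Definition arith_eval (o : arith) (x y : nat) : nat :=
  match o with
  | AAdd => x + y | ASub => x - y | AMul => x * y | ALt => x < y | AEq => x == y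
  end.

(* Variables are de Bruijn levels: the environment is a list to which [ESum] and
   [SFor] append their index, and variable 0 is the input length n. *)
Inductive expr :=
  | EVar of nat
  | ECst of nat
  | EBin of arith & expr & expr
  | ECell of nat & expr & expr
  | EIf of expr & expr & expr
  | ESum of expr & expr.

Inductive stmt :=
  | SStore of nat & expr & expr & expr
  | SSeq of stmt & stmt
  | SFor of expr & stmt.

Definition store := nat -> nat -> nat -> nat.

Definition set_cell (A : store) (f i j v : nat) : store :=
  fun f' i' j' => if [&& f' == f, i' == i & j' == j] then v else A f' i' j'.

Fixpoint ev (rho : seq nat) (A : store) (e : expr) : nat :=
  match e with
  | EVar x => nth 0 rho x
  | ECst c => c
  | EBin o e1 e2 => arith_eval o (ev rho A e1) (ev rho A e2)
  | ECell f e1 e2 => A f (ev rho A e1) (ev rho A e2)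
  | EIf e1 e2 e3 => if ev rho A e1 != 0 then ev rho A e2 else ev rho A e3
  | ESum e1 e2 => \sum_(i < ev rho A e1) ev (rcons rho i) A e2
  end.

Fixpoint sem (rho : seq nat) (s : stmt) (A : store) : store :=
  match s with
  | SStore f e1 e2 e3 => set_cell A f (ev rho A e1) (ev rho A e2) (ev rho A e3)
  | SSeq s1 s2 => sem rho s2 (sem rho s1 A)
  | SFor e s1 => iteri (ev rho A e) (fun i => sem (rcons rho i) s1) A
  end.

(** These are the fields 1 to 14; field 0 is not counted. *)
Definition nfields := 14.

(* Field 0 is the input and output area, the addresses below 2n; the other fields
   are n-by-n arrays stored interleaved above it. *)
Definition addr (n f i j : nat) : nat :=
  if f is f'.+1 then 2 * n + nfields * (i * n + j) + f' else i.

Definition cell_valid (n f i j : nat) : bool :=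
  if f is f'.+1 then [&& f' < nfields, i < n & j < n]
  else (i < 2 * n) && (j == 0).

Lemma addr_lt n f i j :
  cell_valid n f i j -> addr n f i j < 2 * n + nfields * (n * n).
Proof.
case: f => [|f] /=; first by rewrite /nfields; lia.
case/and3P=> fK ilt jlt.
have : i * n + j < n * n by nia.
by move: fK; rewrite /nfields; lia.
Qed.

(** Row, column and field are digits in mixed radix: the field is a remainder modulo [nfields], the
    column one modulo [n]. This makes a write to one array invisible in all the others. *)
Lemma addr_inj n f i j f' i' j' :
  cell_valid n f i j -> cell_valid n f' i' j' ->
  addr n f i j = addr n f' i' j' -> [/\ f = f', i = i' & j = j'].
Proof.
case: f f' => [|f] [|f'] /=; rewrite /nfields.
- by case/andP=> _ /eqP-> /andP[_ /eqP->].
- by move=> /andP[h _] /and3P[]; lia.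
- by move=> /and3P[_ _ _] /andP[]; lia.
move=> /and3P[fK il jl] /and3P[fK' il' jl'] E.
have [E1 Ef] : i * n + j = i' * n + j' /\ f = f' by lia.
have Ei : i = i'.
  have -> : i = (i * n + j) %/ n by rewrite divnMDl ?divn_small //; lia.
  by rewrite E1 divnMDl ?divn_small //; lia.
by split; lia.
Qed.

(** Even registers hold variables and odd ones temporaries, so both families are unbounded and never
    clash; [var 0] is register 0, where the machine finds the input length. *)
Definition var x := 2 * x.
Definition tmp y := (2 * y).+1.

(** The machine only has a conditional jump, so the jump back tests a register just cleared. It
    returns to [off.+1], past the initialisation of the counter; [off + 7 + size body] is the first
    address after the loop. [tmp t] holds the bound, [tmp s] is scratch. *)
Definition loop_code (v t s off : nat) (body : seq instr) : seq instr :=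
  [:: IConst (var v) 0;
      IOp OLt (tmp s) (var v) (tmp t);
      IJz (tmp s) (off + 7 + size body)] ++
  body ++
  [:: IConst (tmp s) 1; IOp OAdd (var v) (var v) (tmp s);
      IConst (tmp s) 0; IJz (tmp s) off.+1].

(** Evaluates [addr] in place on the coordinates in [tmp t] and [tmp t.+1]; the summand 2n is
    [var 0] added twice. *)
Definition addr_code (t f : nat) : seq instr :=
  if f is f'.+1 then
    [:: IOp OMul (tmp t) (tmp t) (var 0);
        IOp OAdd (tmp t) (tmp t) (tmp t.+1);
        IConst (tmp t.+1) nfields;
        IOp OMul (tmp t) (tmp t.+1) (tmp t);
        IConst (tmp t.+1) f';
        IOp OAdd (tmp t) (tmp t) (tmp t.+1);
        IOp OAdd (tmp t) (tmp t) (var 0);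
        IOp OAdd (tmp t) (tmp t) (var 0)]
  else [::].

(* [v] is the number of bound variables, [t] the first free temporary, which
   receives the value, and [off] the address of the first instruction. *)
Fixpoint expr_code (v t off : nat) (e : expr) : seq instr :=
  match e with
  | EVar x => [:: IConst (tmp t) 0; IOp OAdd (tmp t) (var x) (tmp t)]
  | ECst c => [:: IConst (tmp t) c]
  | EBin o e1 e2 =>
    let c1 := expr_code v t off e1 in
    let c2 := expr_code v t.+1 (off + size c1) e2 in
    c1 ++ c2 ++ [:: IOp (arith_op o) (tmp t) (tmp t) (tmp t.+1)]
  | ECell f e1 e2 =>
    let c1 := expr_code v t off e1 in
    let c2 := expr_code v t.+1 (off + size c1) e2 in
    c1 ++ c2 ++ addr_code t f ++ [:: ILoad (tmp t) (tmp t)]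
  | EIf e1 e2 e3 =>
    let c1 := expr_code v t off e1 in
    let c2 := expr_code v t (off + size c1).+1 e2 in
    let off3 := off + size c1 + size c2 + 3 in
    let c3 := expr_code v t off3 e3 in
    c1 ++ [:: IJz (tmp t) off3] ++ c2 ++
    [:: IConst (tmp t.+1) 0; IJz (tmp t.+1) (off3 + size c3)] ++ c3
  | ESum e1 e2 =>
    let c1 := expr_code v t off e1 in
    let off2 := (off + size c1).+1 in
    c1 ++ [:: IConst (tmp t.+1) 0] ++
    loop_code v t t.+2 off2
      (expr_code v.+1 t.+2 (off2 + 3) e2 ++
       [:: IOp OAdd (tmp t.+1) (tmp t.+1) (tmp t.+2)]) ++
    [:: IConst (tmp t.+2) 0; IOp OAdd (tmp t) (tmp t.+1) (tmp t.+2)]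
  end.

(** A store computes the value first, so that the two coordinates land in the next two temporaries,
    where [addr_code] can work on them without touching the value. *)
Fixpoint stmt_code (v t off : nat) (s : stmt) : seq instr :=
  match s with
  | SStore f e1 e2 e3 =>
    let c3 := expr_code v t off e3 in
    let c1 := expr_code v t.+1 (off + size c3) e1 in
    let c2 := expr_code v t.+2 (off + size c3 + size c1) e2 in
    c3 ++ c1 ++ c2 ++ addr_code t.+1 f ++ [:: IStore (tmp t.+1) (tmp t)]
  | SSeq s1 s2 =>
    let c1 := stmt_code v t off s1 in
    c1 ++ stmt_code v t (off + size c1) s2
  | SFor e s1 =>
    let c1 := expr_code v t off e in
    let off2 := off + size c1 in
    c1 ++ loop_code v t t.+1 off2 (stmt_code v.+1 t.+1 (off2 + 3) s1)
  end.

(** * Running time as a polynomial in the input length *)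

Fixpoint expr_time (n : nat) (e : expr) : nat :=
  match e with
  | EVar _ => 2
  | ECst _ => 1
  | EBin _ e1 e2 => expr_time n e1 + (expr_time n e2 + 1)
  | ECell _ e1 e2 => expr_time n e1 + (expr_time n e2 + (8 + 1))
  | EIf e1 e2 e3 => expr_time n e1 + (1 + (expr_time n e2 + expr_time n e3 + 2))
  | ESum e1 e2 =>
    expr_time n e1 + (1 + (n * (expr_time n e2 + 1 + 6) + 3 + 2))
  end.

(** The constants, here and for expressions, count instructions: at most 8 to form an address and 1
    to access it; 6 per iteration of a loop around its body, and 3 for clearing the counter and for
    the last, failing test. *)
Fixpoint stmt_time (n : nat) (s : stmt) : nat :=
  match s with
  | SStore _ e1 e2 e3 =>
    expr_time n e3 + (expr_time n e1 + (expr_time n e2 + (8 + 1)))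
  | SSeq s1 s2 => stmt_time n s1 + stmt_time n s2
  | SFor e s1 => expr_time n e + (n * (stmt_time n s1 + 6) + 3)
  end.

Fixpoint expr_deg (e : expr) : nat :=
  match e with
  | EVar _ | ECst _ => 0
  | EBin _ e1 e2 | ECell _ e1 e2 => maxn (expr_deg e1) (expr_deg e2)
  | EIf e1 e2 e3 => maxn (expr_deg e1) (maxn (expr_deg e2) (expr_deg e3))
  | ESum e1 e2 => maxn (expr_deg e1) (expr_deg e2).+1
  end.

Fixpoint stmt_deg (s : stmt) : nat :=
  match s with
  | SStore _ e1 e2 e3 => maxn (expr_deg e1) (maxn (expr_deg e2) (expr_deg e3))
  | SSeq s1 s2 => maxn (stmt_deg s1) (stmt_deg s2)
  | SFor e s1 => maxn (expr_deg e) (stmt_deg s1).+1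
  end.

Lemma leq_polyW n a d x e :
  0 < n -> x <= a * n ^ d -> d <= e -> x <= a * n ^ e.
Proof. by move=> n0 h de; apply: leq_trans h _; rewrite leq_mul2l leq_pexp2l ?orbT. Qed.

Lemma leq_polyD n d x y a b :
  x <= a * n ^ d -> y <= b * n ^ d -> x + y <= (a + b) * n ^ d.
Proof. by move=> h1 h2; rewrite mulnDl leq_add. Qed.

Lemma leq_polyC n d c : 0 < n -> c <= c * n ^ d.
Proof. by move=> n0; rewrite leq_pmulr // expn_gt0 n0. Qed.

Lemma leq_polyM n d x a : x <= a * n ^ d -> n * x <= a * n ^ d.+1.
Proof. by move=> h; rewrite expnS mulnCA leq_mul2l h orbT. Qed.

Ltac split_poly :=
  repeat match goal with |- is_true (leq (_ + _) _) => apply: leq_polyD end;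
  try exact: leq_polyC.

(** The time is a polynomial in n with natural coefficients, of degree at most the nesting depth of
    loops. It is therefore bounded by the sum of its coefficients, which is its value at 1, times
    the top power of n. *)
Lemma expr_time_poly n e :
  0 < n -> expr_time n e <= expr_time 1 e * n ^ expr_deg e.
Proof.
move=> n0; elim: e => [x|c|o e1 IH1 e2 IH2|f e1 IH1 e2 IH2|e1 IH1 e2 IH2 e3 IH3|e1 IH1 e2 IH2];
  rewrite [expr_time _ _]/= [expr_time 1 _]/= [expr_deg _]/=.
- by [].
- by [].
- split_poly; apply: leq_polyW; eauto; lia.
- split_poly; apply: leq_polyW; eauto; lia.
- split_poly; apply: leq_polyW; eauto; lia.
rewrite mul1n.
apply: leq_polyD; first by apply: leq_polyW; eauto; lia.
apply: leq_polyD; first exact: leq_polyC.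
do 2![apply: leq_polyD; last exact: leq_polyC].
apply: (@leq_polyW _ _ (expr_deg e2).+1) => //; last lia.
by apply: leq_polyM; split_poly.
Qed.

Lemma stmt_time_poly n s :
  0 < n -> stmt_time n s <= stmt_time 1 s * n ^ stmt_deg s.
Proof.
move=> n0; elim: s => [f e1 e2 e3|s1 IH1 s2 IH2|e s IH];
  rewrite [stmt_time _ _]/= [stmt_time 1 _]/= [stmt_deg _]/=.
- split_poly; apply: leq_polyW; try exact: expr_time_poly; lia.
- by apply: leq_polyD; apply: leq_polyW; eauto; lia.
rewrite mul1n; apply: leq_polyD.
  by apply: leq_polyW; try exact: expr_time_poly; lia.
apply: leq_polyD; last exact: leq_polyC.
apply: (@leq_polyW _ _ (stmt_deg s).+1) => //; last lia.
by apply: leq_polyM; split_poly.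
Qed.

(** * Execution of code fragments *)

Definition code_at (P : seq instr) (off : nat) (c : seq instr) : Prop :=
  forall k, k < size c -> onth P (off + k) = onth c k.

Lemma onth_cat (T : Type) (s1 s2 : seq T) k :
  onth (s1 ++ s2) k = if k < size s1 then onth s1 k else onth s2 (k - size s1).
Proof. by elim: s1 k => [|x s1 IH] [|k] //=; rewrite IH. Qed.

Lemma code_at_cat P off c1 c2 :
  code_at P off (c1 ++ c2) -> code_at P off c1 /\ code_at P (off + size c1) c2.
Proof.
move=> h; split=> k kl.
  by rewrite h ?onth_cat ?kl // size_cat; lia.
rewrite -addnA h ?onth_cat ?size_cat ?ltn_add2l //.
by rewrite ifN ?addKn // -leqNgt leq_addr.
Qed.

Lemma code_at_hd P off i c :
  code_at P off (i :: c) -> onth P off = Some i /\ code_at P off.+1 c.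
Proof.
move=> h; split; first by rewrite -(addn0 off) h.
by move=> k kl; rewrite addSnnS h.
Qed.

Section Execution.
Variables (w sp : nat) (P : seq instr).

Definition reach (st : state) (t : nat) (st' : state) : Prop :=
  run w P t st = st' /\
  forall u a, u < t -> accessed P (run w P u st) = Some a -> a < sp.

Lemma reach_trans st1 st2 st3 t1 t2 :
  reach st1 t1 st2 -> reach st2 t2 st3 -> reach st1 (t1 + t2) st3.
Proof.
move=> [<- h1] [<- h2]; split; first by rewrite addnC /run iterD.
move=> u a ult; case: (ltnP u t1) => [/h1|le]; first exact.
have -> : u = (u - t1) + t1 by lia.
by rewrite /run iterD => /h2; apply; lia.
Qed.

(** A Hoare triple between two addresses with a bound [T] on the number of steps; the space bound is
    carried along by [reach]. *)
Definition computes (off off' T : nat) (R M : nat -> nat)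
    (Q : (nat -> nat) -> (nat -> nat) -> Prop) : Prop :=
  exists t R' M',
    [/\ t <= T, reach (State off R M) t (State off' R' M') & Q R' M'].

Lemma computes_ret off R M (Q : _ -> _ -> Prop) : Q R M -> computes off off 0 R M Q.
Proof. by move=> h; exists 0, R, M; split. Qed.

Lemma computes_seq off1 off2 off3 T1 T2 R M Q1 Q2 :
  computes off1 off2 T1 R M Q1 ->
  (forall R1 M1, Q1 R1 M1 -> computes off2 off3 T2 R1 M1 Q2) ->
  computes off1 off3 (T1 + T2) R M Q2.
Proof.
move=> [t [R1 [M1 [tl r q]]]] /(_ _ _ q) [t' [R2 [M2 [tl' r' q']]]].
by exists (t + t'), R2, M2; split=> //; [exact: leq_add|exact: reach_trans r r'].
Qed.

Lemma computes_weaken off off' T T' R M (Q Q' : _ -> _ -> Prop) :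
  computes off off' T R M Q -> T <= T' -> (forall R M, Q R M -> Q' R M) ->
  computes off off' T' R M Q'.
Proof.
move=> [t [R1 [M1 [tl r q]]]] TT QQ; exists t, R1, M1; split=> //; last exact: QQ.
exact: leq_trans TT.
Qed.

Definition straight (i : instr) : bool :=
  match i with IConst _ _ | IOp _ _ _ _ => true | _ => false end.

Definition exec_regs (R : nat -> nat) (i : instr) : nat -> nat :=
  match i with
  | IConst r c => upd R r (c %% 2 ^ w)
  | IOp o r a b => upd R r (eval_op w o (R a) (R b))
  | _ => R
  end.

Lemma computes_line off c R M :
  all straight c -> code_at P off c ->
  computes off (off + size c) (size c) R M
    (fun R' M' => R' = foldl exec_regs R c /\ M' = M).
Proof.
elim: c off R => [|i c IH] off R /=.
  by move=> _ _; rewrite addn0; apply: computes_ret.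
move=> /andP[si sc] /code_at_hd[hi hc].
rewrite addnS -addSn -[(size c).+1]add1n.
apply: (@computes_seq _ off.+1 _ _ _ _ _
          (fun R' M' => R' = exec_regs R i /\ M' = M)); last first.
  by move=> R1 M1 [-> ->]; apply: IH.
exists 1, (exec_regs R i), M; split=> //; split.
  by rewrite /run /= /step /= hi; case: i si {hi}.
by case=> // a _; rewrite /accessed /= hi; case: i si {hi}.
Qed.

Lemma computes_jz off r l R M :
  onth P off = Some (IJz r l) ->
  computes off (if R r == 0 then l else off.+1) 1 R M
    (fun R' M' => R' = R /\ M' = M).
Proof.
move=> h; exists 1, R, M; split=> //; split.
  by rewrite /run /= /step /= h.
by case=> // a _; rewrite /accessed /= h.
Qed.

Lemma computes_load off r a R M :
  onth P off = Some (ILoad r a) -> R a < sp ->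
  computes off off.+1 1 R M (fun R' M' => R' = upd R r (M (R a)) /\ M' = M).
Proof.
move=> h lt; exists 1, (upd R r (M (R a))), M; split=> //; split.
  by rewrite /run /= /step /= h.
by case=> // b _; rewrite /accessed /= h => -[<-].
Qed.

Lemma computes_store off a r R M :
  onth P off = Some (IStore a r) -> R a < sp ->
  computes off off.+1 1 R M (fun R' M' => R' = R /\ M' = upd M (R a) (R r)).
Proof.
move=> h lt; exists 1, R, (upd M (R a) (R r)); split=> //; split.
  by rewrite /run /= /step /= h.
by case=> // b _; rewrite /accessed /= h => -[<-].
Qed.

(** Frame condition of compiled code: bound variables and pending temporaries survive, everything
    above them is scratch. *)
Definition agree (v t : nat) (R R' : nat -> nat) : Prop :=
  (forall x, x < v -> R' (var x) = R (var x)) /\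
  (forall y, y < t -> R' (tmp y) = R (tmp y)).

Lemma agree_trans v t v' t' R1 R2 R3 :
  agree v t R1 R2 -> agree v' t' R2 R3 -> v <= v' -> t <= t' ->
  agree v t R1 R3.
Proof.
move=> [h1 h2] [h3 h4] vv tt; split=> x xl.
  by rewrite h3 ?h1 //; apply: leq_trans vv.
by rewrite h4 ?h2 //; apply: leq_trans tt.
Qed.

Lemma eq_var x y : (var x == var y) = (x == y). Proof. rewrite /var; lia. Qed.
Lemma eq_tmp x y : (tmp x == tmp y) = (x == y). Proof. rewrite /tmp; lia. Qed.
Lemma eq_vartmp x y : (var x == tmp y) = false. Proof. rewrite /var /tmp; lia. Qed.
Lemma eq_tmpvar x y : (tmp x == var y) = false. Proof. rewrite /var /tmp; lia. Qed.
Definition eq_reg := (eq_var, eq_tmp, eq_vartmp, eq_tmpvar).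

Lemma agree_upd_tmp v t s x R : t <= s -> agree v t R (upd R (tmp s) x).
Proof.
by move=> ts; split=> y yl; rewrite /upd eq_reg //; case: eqP => // e; lia.
Qed.

Lemma agree_upd_var v t s x R : v <= s -> agree v t R (upd R (var s) x).
Proof.
by move=> ts; split=> y yl; rewrite /upd eq_reg //; case: eqP => // e; lia.
Qed.

Hypothesis B_gt1 : 1 < 2 ^ w.

(** The invariant has to survive changes of the counter and of the temporaries from [s] on, since
    the loop overhead writes [var v] and [tmp s]. The body must leave the counter intact, and the
    bound on [b] keeps the increment from wrapping around. *)
Lemma computes_loop off v t s body T b R M
    (I : nat -> (nat -> nat) -> (nat -> nat) -> Prop) :
  code_at P off (loop_code v t s off body) ->
  b < 2 ^ w ->
  (forall i R M, I i R M -> R (tmp t) = b) ->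
  (forall i R R' M, I i R M -> agree v s R R' -> I i R' M) ->
  I 0 R M ->
  (forall i R M, i < b -> I i R M -> R (var v) = i ->
     computes (off + 3) (off + 3 + size body) T R M
       (fun R' M' => I i.+1 R' M' /\ R' (var v) = i)) ->
  computes off (off + size (loop_code v t s off body)) (b * (T + 6) + 3) R M (I b).
Proof.
move=> hc bB It Iag I0 Ib.
have cmod0 : 0 %% 2 ^ w = 0 by rewrite mod0n.
have cmod1 : 1 %% 2 ^ w = 1 by rewrite modn_small.
have -> : off + size (loop_code v t s off body) = off + 7 + size body.
  by rewrite /loop_code !size_cat /=; lia.
move: hc; rewrite /loop_code => /code_at_cat[/code_at_hd[c0 ch] /code_at_cat[_ ct]].
rewrite /= in ct.
have {ch}[c1 /code_at_hd[c2 _]] := code_at_hd ch.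
(* Induction on the number [d] of iterations left, with the program counter at the test, which is
   the target of the jump back. *)
suff H d : forall i R M, i + d = b -> I i R M -> R (var v) = i ->
    computes off.+1 (off + 7 + size body) (d * (T + 6) + 2) R M (I b).
  have -> : b * (T + 6) + 3 = 1 + (b * (T + 6) + 2) by lia.
  apply: (@computes_seq _ off.+1 _ _ _ _ _ (fun R' M' => I 0 R' M' /\ R' (var v) = 0)).
    have := @computes_line off [:: IConst (var v) 0] R M isT.
    rewrite /= addn1 => h; apply: (computes_weaken (h _)) => //.
      by case=> [|[]] //; rewrite addn0.
    move=> R1 M1 [-> ->]; split; last by rewrite /upd eqxx cmod0.
    by apply: Iag I0 _; exact: agree_upd_var.
  by move=> R1 M1 [I1 e1]; apply: H I1 e1; rewrite add0n.
elim: d => [|d IHd] i R1 M1 idb I1 Rv.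
  apply: (@computes_seq _ off.+2 _ 1 1 _ _
            (fun R' M' => I b R' M' /\ R' (tmp s) = 0)).
    have := @computes_line off.+1 [:: IOp OLt (tmp s) (var v) (tmp t)] R1 M1 isT.
    rewrite /= addn1 => h; apply: (computes_weaken (h _)) => //.
      by case=> [|[]] //; rewrite addn0.
    move=> R2 M2 [-> ->]; split.
      by rewrite -idb addn0; apply: Iag I1 _; exact: agree_upd_tmp.
    have ib : (i < b) = false by lia.
    by rewrite /upd eqxx Rv (It _ _ _ I1) /eval_op ib mod0n.
  move=> R2 M2 [I2 e2]; have := computes_jz R2 M2 c2.
  rewrite e2 eqxx => h; apply: (computes_weaken h) => // R3 M3 [-> ->].
  by [].
have ib : i < b by lia.
have -> : d.+1 * (T + 6) + 2 = 1 + (1 + (T + (3 + (1 + (d * (T + 6) + 2))))) by lia.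
apply: (@computes_seq _ off.+2 _ _ _ _ _
          (fun R' M' => [/\ I i R' M', R' (tmp s) = 1 & R' (var v) = i])).
  have := @computes_line off.+1 [:: IOp OLt (tmp s) (var v) (tmp t)] R1 M1 isT.
  rewrite /= addn1 => h; apply: (computes_weaken (h _)) => //.
    by case=> [|[]] //; rewrite addn0.
  move=> R2 M2 [-> ->]; split.
  - by apply: Iag I1 _; exact: agree_upd_tmp.
  - by rewrite /upd eqxx Rv (It _ _ _ I1) /eval_op ib cmod1.
  - by rewrite /upd eq_reg.
move=> R2 M2 [I2 e2 v2].
apply: (@computes_seq _ (off + 3) _ _ _ _ _
          (fun R' M' => I i R' M' /\ R' (var v) = i)).
  have := computes_jz R2 M2 c2; rewrite e2 /= -addn3 => h.
  by apply: (computes_weaken h) => // R3 M3 [-> ->].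
move=> R3 M3 [I3 v3].
apply: (computes_seq (Ib i R3 M3 ib I3 v3)) => R4 M4 [I4 v4].
have [ct1 /code_at_hd[c3 _]] :
    code_at P (off + 3 + size body)
       [:: IConst (tmp s) 1; IOp OAdd (var v) (var v) (tmp s); IConst (tmp s) 0] /\
    code_at P (off + 3 + size body + 3) [:: IJz (tmp s) off.+1].
  exact: (@code_at_cat P _ [:: _; _; _] [:: _] ct).
apply: (@computes_seq _ (off + 3 + size body + 3) _ _ _ _ _
          (fun R' M' => [/\ I i.+1 R' M', R' (tmp s) = 0 & R' (var v) = i.+1])).
  apply: (computes_weaken (computes_line R4 M4 _ ct1)) => //= R5 M5 [-> ->].
  rewrite /upd !eq_reg !eqxx v4 /eval_op cmod0 cmod1; split=> //; last first.
    by rewrite addn1 modn_small //; lia.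
  apply: Iag I4 _; rewrite -/(upd _ _ _).
  split=> y yl; rewrite /upd ?eq_reg //; do 3?[case: eqP => // e; try lia].
move=> R5 M5 [I5 e5 v5].
apply: (@computes_seq _ off.+1 _ _ _ _ _
          (fun R' M' => I i.+1 R' M' /\ R' (var v) = i.+1)).
  have := computes_jz R5 M5 c3; rewrite e5 eqxx => h.
  by apply: (computes_weaken h) => // R6 M6 [-> ->].
by move=> R6 M6 [I6 v6]; apply: IHd I6 v6; lia.
Qed.

End Execution.

(** * Overflow conditions and correctness of the compiler *)

Definition arith_ok (B : nat) (o : arith) (x y : nat) : bool :=
  match o with
  | AAdd | AMul => arith_eval o x y < B
  | ASub => y <= x
  | ALt | AEq => true
  end.

(** Conditions under which the machine agrees with natural number arithmetic: no result wraps
    around, no subtraction truncates, no access leaves the arrays. Loops make at most n iterations,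
    as charged by [expr_time]. Only the branch taken by a conditional is checked, so that a test can
    guard an array access. *)
Fixpoint expr_ok (n B : nat) (rho : seq nat) (A : store) (e : expr) : Prop :=
  match e with
  | EVar x => x < size rho
  | ECst c => c < B
  | EBin o e1 e2 =>
    [/\ expr_ok n B rho A e1, expr_ok n B rho A e2
      & arith_ok B o (ev rho A e1) (ev rho A e2)]
  | ECell f e1 e2 =>
    [/\ expr_ok n B rho A e1, expr_ok n B rho A e2
      & cell_valid n f (ev rho A e1) (ev rho A e2)]
  | EIf e1 e2 e3 =>
    [/\ expr_ok n B rho A e1,
        ev rho A e1 != 0 -> expr_ok n B rho A e2
      & ev rho A e1 = 0 -> expr_ok n B rho A e3]
  | ESum e1 e2 =>
    [/\ expr_ok n B rho A e1, ev rho A e1 <= n,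
        forall i, i < ev rho A e1 -> expr_ok n B (rcons rho i) A e2
      & \sum_(i < ev rho A e1) ev (rcons rho i) A e2 < B]
  end.

Fixpoint stmt_ok (n B : nat) (rho : seq nat) (A : store) (s : stmt) : Prop :=
  match s with
  | SStore f e1 e2 e3 =>
    [/\ expr_ok n B rho A e1, expr_ok n B rho A e2, expr_ok n B rho A e3
      & cell_valid n f (ev rho A e1) (ev rho A e2)]
  | SSeq s1 s2 => stmt_ok n B rho A s1 /\ stmt_ok n B rho (sem rho s1 A) s2
  | SFor e s1 =>
    [/\ expr_ok n B rho A e, ev rho A e <= n
      & forall i, i < ev rho A e ->
        stmt_ok n B (rcons rho i) (iteri i (fun i => sem (rcons rho i) s1) A) s1]
  end.

Section Compiler.
Variables (w n sp : nat) (P : seq instr).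
Hypothesis n_lt : n < 2 ^ w.
Hypothesis nfields_lt : nfields < 2 ^ w.
Hypothesis sp_le : sp <= 2 ^ w.
Hypothesis cells_le : 2 * n + nfields * (n * n) <= sp.

Notation B := (2 ^ w).

Let B_gt1 : 1 < B. Proof. exact: leq_ltn_trans nfields_lt. Qed.

Lemma eval_arith o x y :
  x < B -> y < B -> arith_ok B o x y ->
  eval_op w (arith_op o) x y = arith_eval o x y.
Proof.
case: o => /= xB yB h; rewrite /eval_op.
- by rewrite modn_small.
(* The machine subtracts by adding 2^w - y; as y <= x, the surplus is exactly one modulus. Stating
   this for any [b] keeps the power away from [lia]. *)
- have E b : y < b -> x + (b - y) = (x - y) + b by lia.
  rewrite (E _ yB).
  by rewrite modnDr modn_small // (leq_ltn_trans (leq_subr _ _) xB).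
- by rewrite modn_small.
- by rewrite modn_small //; apply: leq_ltn_trans B_gt1; case: (_ < _).
- by rewrite modn_small //; apply: leq_ltn_trans B_gt1; case: (_ == _).
Qed.

Lemma arith_lt o x y : x < B -> arith_ok B o x y -> arith_eval o x y < B.
Proof.
case: o => //= xB h; first exact: leq_ltn_trans (leq_subr _ _) xB.
- by apply: leq_ltn_trans B_gt1; case: (_ < _).
- by apply: leq_ltn_trans B_gt1; case: (_ == _).
Qed.

(** The bound on the values belongs to the relation because whatever is read from a cell must again
    be a word. *)
Definition store_rel (A : store) (M : nat -> nat) : Prop :=
  forall f i j, cell_valid n f i j -> M (addr n f i j) = A f i j /\ A f i j < B.

Definition env_rel (rho : seq nat) (R : nat -> nat) : Prop :=
  [/\ 0 < size rho, nth 0 rho 0 = n,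
      forall x, x < size rho -> nth 0 rho x < B
    & forall x, x < size rho -> R (var x) = nth 0 rho x].

Lemma env_rel_agree rho t R R' :
  env_rel rho R -> agree (size rho) t R R' -> env_rel rho R'.
Proof.
move=> [h0 hn hb h] [ha _]; split=> // x xl.
by rewrite ha ?h.
Qed.

Lemma env_rel_push rho R i :
  env_rel rho R -> i < B -> R (var (size rho)) = i -> env_rel (rcons rho i) R.
Proof.
move=> [h0 hn hb h] iB hi; split; rewrite ?size_rcons ?nth_rcons ?h0 //.
  move=> x; rewrite ltnS nth_rcons leq_eqVlt => /orP[/eqP->|xl].
    by rewrite ltnn eqxx.
  by rewrite xl hb.
move=> x; rewrite ltnS nth_rcons leq_eqVlt => /orP[/eqP->|xl].
  by rewrite ltnn eqxx.
by rewrite xl h.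
Qed.

Lemma ev_lt A M R rho e :
  store_rel A M -> env_rel rho R -> expr_ok n B rho A e -> ev rho A e < B.
Proof.
move=> hA [h0 hn hb _].
elim: e => [x|c|o e1 IH1 e2 IH2|f e1 IH1 e2 IH2|e1 IH1 e2 IH2 e3 IH3|e1 IH1 e2 IH2] /=.
- exact: hb.
- by [].
- by move=> [/IH1 h1 /IH2 h2]; apply: arith_lt.
- by move=> [_ _ /hA[]].
- by case: eqP => /= [e [_ _ /(_ e)/IH3]|e [_ /(_ isT)/IH2]].
- by case.
Qed.

Lemma addr_code_correct off t f i j v R M :
  code_at P off (addr_code t f) ->
  R (var 0) = n -> R (tmp t) = i -> R (tmp t.+1) = j -> cell_valid n f i j ->
  computes w sp P off (off + size (addr_code t f)) 8 R M
    (fun R' M' => [/\ M' = M, agree v t R R' & R' (tmp t) = addr n f i j]).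
Proof.
case: f => [|f] hc hn hi hj hv.
  by rewrite addn0; exists 0, R, M.
have hadd x y : x + y < B -> eval_op w OAdd x y = x + y by move=> h; rewrite /eval_op modn_small.
have hmul x y : x * y < B -> eval_op w OMul x y = x * y by move=> h; rewrite /eval_op modn_small.
have ha := addr_lt hv; case/and3P: hv => hf il jl; rewrite /= in ha hf.
have hin : i * n + j < n * n by nia.
have t1 : (t == t.+1) = false by lia.
have t2 : (t.+1 == t) = false by lia.
have hf' : f < nfields by [].
(* Every partial result is at most the final address, which is below [sp] and hence below 2^w; these
   inequalities let [lia] see it. *)
have nK : n * n <= nfields * (n * n) by rewrite /nfields; lia.
have ijK : i * n + j <= nfields * (i * n + j) by rewrite /nfields; lia.
apply: (computes_weaken (computes_line w sp R M _ hc)) => // R' M' [-> ->].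
split=> //.
  split=> y yl; rewrite [addr_code _ _]/= [foldl _ _ _]/= /upd !eq_reg //.
  by do !(case: eqP => [?|_]; first lia).
rewrite [addr_code _ _]/= [foldl _ _ _]/= /upd !(eq_reg, eqxx, t1, t2).
rewrite hn hi hj.
rewrite (hmul i n); last lia.
rewrite (hadd (i * n) j); last lia.
rewrite (modn_small nfields_lt) (modn_small (ltn_trans hf' nfields_lt)).
rewrite hmul; last lia.
rewrite (hadd _ f); last lia.
rewrite (hadd (nfields * (i * n + j) + f) n); last lia.
rewrite (hadd _ n); last lia.
by rewrite /addr; lia.
Qed.

(** The frame condition in the conclusion lets the value of one operand wait in [tmp t] while the
    other is computed from [tmp t.+1] on. In a sum, [tmp t] keeps the bound and [tmp t.+1] the
    partial sum, while [tmp t.+2] serves the loop test and the summand. *)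
Lemma expr_code_correct e rho t off A R M :
  code_at P off (expr_code (size rho) t off e) ->
  store_rel A M -> env_rel rho R -> expr_ok n B rho A e ->
  computes w sp P off (off + size (expr_code (size rho) t off e))
    (expr_time n e) R M
    (fun R' M' =>
      [/\ M' = M, agree (size rho) t R R' & R' (tmp t) = ev rho A e]).
Proof.
elim: e rho t off R => [x|c|o e1 IH1 e2 IH2|f e1 IH1 e2 IH2|e1 IH1 e2 IH2 e3 IH3|e1 IH1 e2 IH2]
  rho t off R hc hA hr hok.
- apply: (computes_weaken (computes_line w sp R M _ hc)) => // R' M' [-> ->].
  case: hr => _ _ hb hR; rewrite /= in hok *; split=> //.
    by apply: agree_trans (agree_upd_tmp _ _ _ (leqnn t)) (agree_upd_tmp _ _ _ (leqnn t)) _ _.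
  rewrite /upd !eq_reg !eqxx /eval_op mod0n addn0 hR // modn_small //.
  exact: hb.
- apply: (computes_weaken (computes_line w sp R M _ hc)) => // R' M' [-> ->].
  rewrite /= in hok *; split=> //; first exact: agree_upd_tmp.
  by rewrite /upd eqxx modn_small.
- move: hc hok; rewrite [expr_code _ _ _ _]/= => /code_at_cat[c1 /code_at_cat[c2 c3]].
  move=> [ok1 ok2 oko]; rewrite !size_cat !addnA.
  apply: (computes_seq (IH1 _ _ _ _ c1 hA hr ok1)) => R1 M1 [-> ag1 e1v].
  have hr1 := env_rel_agree hr ag1.
  apply: (computes_seq (IH2 _ _ _ _ c2 hA hr1 ok2)) => R2 M2 [-> ag2 e2v].
  apply: (computes_weaken (computes_line w sp R2 M _ c3)) => // R' M' [-> ->].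
  have ag := agree_trans ag1 ag2 (leqnn _) (leqnSn _).
  split=> //=.
    by apply: agree_trans ag (agree_upd_tmp _ _ _ (leqnn t)) _ _.
  rewrite /upd eqxx e2v; have [_ ->] := ag2; last by [].
  by rewrite e1v eval_arith //; [exact: (ev_lt hA hr)|exact: (ev_lt hA hr)].
- move: hc hok; rewrite [expr_code _ _ _ _]/=.
  move=> /code_at_cat[c1 /code_at_cat[c2 /code_at_cat[c3 /code_at_hd[c4 _]]]].
  move=> [ok1 ok2 okv]; rewrite !size_cat !addnA.
  apply: (computes_seq (IH1 _ _ _ _ c1 hA hr ok1)) => R1 M1 [-> ag1 e1v].
  have hr1 := env_rel_agree hr ag1.
  apply: (computes_seq (IH2 _ _ _ _ c2 hA hr1 ok2)) => R2 M2 [-> ag2 e2v].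
  have hr2 := env_rel_agree hr1 ag2.
  have e1v2 : R2 (tmp t) = ev rho A e1 by have [_ ->] := ag2.
  have R0 : R2 (var 0) = n by have [s0 <- _ ->] := hr2.
  apply: (computes_seq (addr_code_correct (size rho) _ c3 R0 e1v2 e2v okv)).
  move=> R3 M3 [-> ag3 e3v].
  have [hAv _] := hA _ _ _ okv.
  rewrite addn1; apply: (computes_weaken (computes_load w (sp := sp) _ c4 _)) => //.
    by rewrite e3v; apply: leq_trans (addr_lt okv) _.
  move=> R4 M4 [-> ->]; split=> //; last by rewrite /upd eqxx e3v hAv.
  apply: agree_trans (agree_trans ag1 ag2 (leqnn _) (leqnSn _)) _ (leqnn _) (leqnn _).
  apply: agree_trans ag3 _ (leqnn _) (leqnn _); exact: agree_upd_tmp.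
- move: hc hok; rewrite [expr_code _ _ _ _]/=.
  set s1 := size (expr_code _ _ _ e1).
  set c2' := expr_code _ _ _ e2; set c3' := expr_code _ _ _ e3.
  move=> /code_at_cat[c1 /code_at_hd[cj /code_at_cat[c2 /code_at_hd[ck]]]].
  move=> /code_at_hd[cl c3] [ok1 ok2 ok3].
  apply: (computes_seq (IH1 _ _ _ _ c1 hA hr ok1)) => R1 M1 [-> ag1 e1v].
  have hr1 := env_rel_agree hr ag1.
  apply: (computes_seq (computes_jz w sp R1 M cj)) => R2 M2 [-> ->].
  rewrite !size_cat /= size_cat /= -/s1.
  rewrite e1v; case: eqP => [e0|/eqP e0] /=.
    have E3 : off + s1 + size c2' + 3 = (off + s1).+1 + size c2' + 2 by lia.
    have c3b : code_at P (off + s1 + size c2' + 3) c3' by rewrite E3 addn2.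
    apply: (computes_weaken (Q := fun R' M' =>
        [/\ M' = M, agree (size rho) t R1 R' & R' (tmp t) = ev rho A e3]) (T := expr_time n e3)).
    - have := IH3 _ _ _ _ c3b hA hr1 (ok3 e0).
      rewrite -/c3'; set o1 := (X in computes _ _ _ _ X); set o2 := (X in _ -> computes _ _ _ _ X _ _ _ _).
      by have -> : o1 = o2 by rewrite /o1 /o2; lia.
    - change (expr_time n e3 <= expr_time n e2 + expr_time n e3 + 2); lia.
    - by move=> R3 M3 [-> ag3 e3v]; split=> //; apply: agree_trans ag1 ag3 _ _.
  apply: (computes_weaken (T := expr_time n e2 + (1 + 1)) (Q := fun R' M' =>
        [/\ M' = M, agree (size rho) t R1 R' & R' (tmp t) = ev rho A e2])).
  - apply: (computes_seq (IH2 _ _ _ _ c2 hA hr1 (ok2 e0))) => R3 M3 [-> ag3 e3v].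
    apply: (@computes_seq _ _ _ _ ((off + s1).+1 + size c2').+1 _ _ _ _ _
        (fun R' M' => [/\ M' = M, agree (size rho) t R1 R', R' (tmp t) = ev rho A e2 & R' (tmp t.+1) = 0])).
      have := @computes_line w sp P ((off + s1).+1 + size c2') [:: IConst (tmp t.+1) 0] R3 M isT.
      rewrite /= addn1 => h; apply: (computes_weaken (h _)) => //.
        by case=> [|[]] //; rewrite addn0.
      move=> R4 M4 [-> ->]; split=> //.
      + by apply: agree_trans ag3 _ (leqnn _) (leqnn _); apply: agree_upd_tmp.
      + by rewrite /upd eq_reg ifF //; lia.
      + by rewrite /upd eqxx mod0n.
    move=> R4 M4 [-> ag4 e4 e4'].
    have := computes_jz w sp R4 M cl; rewrite e4' eqxx.
    set o1 := (X in computes _ _ _ _ X); set o2 := (X in _ -> computes _ _ _ _ X _ _ _ _).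
    have -> : o1 = o2 by rewrite /o1 /o2 -/c3'; lia.
    by move=> h; apply: (computes_weaken h) => // R5 M5 [-> ->].
  - change (expr_time n e2 + (1 + 1) <= expr_time n e2 + expr_time n e3 + 2); lia.
  - by move=> R3 M3 [-> ag3 e3v]; split=> //; apply: agree_trans ag1 ag3 _ _.
set off2 := (off + size (expr_code (size rho) t off e1)).+1.
have E : expr_code (size rho) t off (ESum e1 e2) =
    expr_code (size rho) t off e1 ++ [:: IConst (tmp t.+1) 0] ++
    loop_code (size rho) t t.+2 off2
      (expr_code (size rho).+1 t.+2 (off2 + 3) e2 ++
       [:: IOp OAdd (tmp t.+1) (tmp t.+1) (tmp t.+2)]) ++
    [:: IConst (tmp t.+2) 0; IOp OAdd (tmp t) (tmp t.+1) (tmp t.+2)] by [].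
rewrite E in hc *; move: hc hok => {E}.
rewrite [expr_time _ _]/=; set lc := loop_code _ _ _ _ _.
move=> /code_at_cat[c1 /(@code_at_cat _ _ [:: _])[c2 /code_at_cat[c3 c4]]] [ok1 okn ok2 okS].
rewrite 3!size_cat.
rewrite addnA; apply: (computes_seq (IH1 _ _ _ _ c1 hA hr ok1)) => R1 M1 [-> ag1 e1v].
have hr1 := env_rel_agree hr ag1.
rewrite addnA; apply: (computes_seq (computes_line w sp R1 M _ c2)) => // R2 M2 [eR2 ->].
pose F (i : nat) := ev (rcons rho i) A e2.
pose I (i : nat) R' M' := [/\ M' = M, agree (size rho) t R R',
   R' (tmp t) = ev rho A e1 & R' (tmp t.+1) = \sum_(j < i) F j].
have E2 : off + size (expr_code (size rho) t off e1) +
    size [:: IConst (tmp t.+1) 0] = off2 by rewrite addn1.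
rewrite addnA E2; rewrite E2 in c3 c4.
(* The summands are natural numbers, so partial sums inherit the bound that is required of the
   total. *)
have SF i : i <= ev rho A e1 -> \sum_(j < i) F j < B.
  move=> ile; apply: leq_ltn_trans okS.
  rewrite -!(big_mkord xpredT F) /=.
  by rewrite [leqRHS](big_cat_nat (leq0n i) ile) leq_addr.
apply: (@computes_seq _ _ _ _ _ _ _ _ _ _ (I (ev rho A e1))).
  apply: (computes_weaken (T := ev rho A e1 * (expr_time n e2 + 1 + 6) + 3)
            (Q := I (ev rho A e1))) => //; last by apply: leq_add => //; exact: leq_mul.
  apply: (computes_loop B_gt1 c3) => //.
  - exact: leq_ltn_trans n_lt.
  - by move=> i R3 M3 [].
  - move=> i R3 R4 M3 [-> ag3 h3 h3'] ag4; split=> //.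
    + by apply: agree_trans ag3 ag4 _ _; lia.
    + by have [_ ->] := ag4.
    + by have [_ ->] := ag4.
  - have ag2 : agree (size rho) t.+1 R1 R2 by rewrite eR2; exact: agree_upd_tmp.
    split=> //.
    + by apply: agree_trans ag1 ag2 _ _.
    + by have [_ ->] := ag2.
    + by rewrite eR2 /= /upd eqxx mod0n big_ord0.
  move=> i R3 M3 ilt [-> ag3 h3 h3'] hv.
  move: c3; rewrite /lc /loop_code => /code_at_cat[_ /code_at_cat[/code_at_cat[c5 c6] _]].
  have hr3 : env_rel (rcons rho i) R3.
    apply: env_rel_push hv; first exact: env_rel_agree hr ag3.
    exact: ltn_trans ilt (leq_ltn_trans okn n_lt).
  rewrite size_cat addnA.
  have e7 : size (rcons rho i) = (size rho).+1 by rewrite size_rcons.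
  have := IH2 (rcons rho i) t.+2 (off2 + 3) R3.
  rewrite e7 => IH; apply: (computes_seq (IH c5 hA hr3 (ok2 i ilt))) => R4 M4 [-> ag4 e4v].
  apply: (computes_weaken (computes_line w sp R4 M _ c6)) => // R5 M5 [-> ->].
  rewrite /= /upd !eq_reg; split; last first.
    by have [-> //] := ag4.
  have h4 : R4 (tmp t.+1) = \sum_(j < i) F j by have [_ ->] := ag4.
  have agr : agree (size rho) t R R4.
    by apply: agree_trans ag3 ag4 _ _; lia.
  split=> //.
  + by apply: agree_trans agr (agree_upd_tmp _ _ _ (leqnSn t)) _ _.
  + rewrite !eq_reg ifF; last lia.
    by have [_ ->] := ag4.
  + rewrite eqxx e4v h4 /eval_op big_ord_recr /= modn_small //.
    by have := SF i.+1 ilt; rewrite big_ord_recr.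
move=> R3 M3 [-> ag3 h3 h3'].
apply: (computes_weaken (computes_line w sp R3 M _ c4)) => // R4 M4 [-> ->].
split=> //=.
  apply: agree_trans ag3 _ (leqnn _) (leqnn _).
  by apply: agree_trans (agree_upd_tmp _ _ _ _) (agree_upd_tmp _ _ _ _) (leqnn _) (leqnn _); lia.
rewrite /upd !eqxx !eq_reg ifF; last lia.
by rewrite h3' mod0n /eval_op addn0 modn_small // SF.
Qed.

Lemma store_rel_set A M f i j x :
  store_rel A M -> cell_valid n f i j -> x < B ->
  store_rel (set_cell A f i j x) (upd M (addr n f i j) x).
Proof.
move=> hA hv xB f' i' j' hv'; rewrite /upd /set_cell.
case: eqP => [/(addr_inj hv' hv)[-> -> ->]|ne]; first by rewrite !eqxx.
rewrite ifN; first exact: hA.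
by apply/negP => /and3P[/eqP e1 /eqP e2 /eqP e3]; apply: ne; rewrite e1 e2 e3.
Qed.

Lemma stmt_code_correct s rho t off A R M :
  code_at P off (stmt_code (size rho) t off s) ->
  store_rel A M -> env_rel rho R -> stmt_ok n B rho A s ->
  computes w sp P off (off + size (stmt_code (size rho) t off s))
    (stmt_time n s) R M
    (fun R' M' => store_rel (sem rho s A) M' /\ agree (size rho) t R R').
Proof.
elim: s rho t off A R M => [f e1 e2 e3|s1 IH1 s2 IH2|e s IH] rho t off A R M hc hA hr hok.
- move: hc hok; rewrite [stmt_code _ _ _ _]/=.
  move=> /code_at_cat[c3 /code_at_cat[c1 /code_at_cat[c2 /code_at_cat[c4 /code_at_hd[c5 _]]]]].
  move=> [ok1 ok2 ok3 okv]; rewrite !size_cat !addnA.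
  apply: (computes_seq (expr_code_correct c3 hA hr ok3)) => R1 M1 [-> ag1 e3v].
  have hr1 := env_rel_agree hr ag1.
  apply: (computes_seq (expr_code_correct c1 hA hr1 ok1)) => R2 M2 [-> ag2 e1v].
  have hr2 := env_rel_agree hr1 ag2.
  apply: (computes_seq (expr_code_correct c2 hA hr2 ok2)) => R3 M3 [-> ag3 e2v].
  have hr3 := env_rel_agree hr2 ag3.
  have e1v3 : R3 (tmp t.+1) = ev rho A e1 by have [_ ->] := ag3.
  have R0 : R3 (var 0) = n by have [s0 <- _ ->] := hr3.
  apply: (computes_seq (addr_code_correct (size rho) _ c4 R0 e1v3 e2v okv)).
  move=> R4 M4 [-> ag4 e4v].
  have e3v4 : R4 (tmp t) = ev rho A e3.
    by have [_ ->] := ag4 => //; have [_ ->] := ag3 => //; have [_ ->] := ag2.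
  rewrite addn1; apply: (computes_weaken (computes_store w (sp := sp) _ c5 _)) => //.
    by rewrite e4v; apply: leq_trans (addr_lt okv) _.
  move=> R5 M5 [-> ->]; rewrite e4v e3v4; split.
    by apply: store_rel_set => //; apply: ev_lt hA hr ok3.
  have ag23 := agree_trans ag2 ag3 (leqnn _) (leqnSn _).
  exact: agree_trans ag1 (agree_trans ag23 ag4 (leqnn _) (leqnn _)) (leqnn _) (leqnSn _).
- move: hc hok; rewrite [stmt_code _ _ _ _]/= => /code_at_cat[c1 c2] [ok1 ok2].
  rewrite size_cat addnA.
  apply: (computes_seq (IH1 _ _ _ _ _ _ c1 hA hr ok1)) => R1 M1 [hA1 ag1].
  have hr1 := env_rel_agree hr ag1.
  apply: (computes_weaken (IH2 _ _ _ _ _ _ c2 hA1 hr1 ok2)) => // R2 M2 [hA2 ag2].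
  by split=> //; apply: agree_trans ag1 ag2 _ _.
move: hc hok; rewrite [stmt_code _ _ _ _]/= => /code_at_cat[c1 c2] [ok1 okn ok2].
rewrite size_cat addnA.
apply: (computes_seq (expr_code_correct c1 hA hr ok1)) => R1 M1 [-> ag1 e1v].
pose I (i : nat) R' M' := [/\ store_rel (iteri i (fun i => sem (rcons rho i) s) A) M',
   agree (size rho) t R R' & R' (tmp t) = ev rho A e].
apply: (computes_weaken (T := ev rho A e * (stmt_time n s + 6) + 3)
            (Q := I (ev rho A e))) => //; last first.
- by move=> R2 M2 [].
- by apply: leq_add => //; exact: leq_mul.
apply: (computes_loop B_gt1 c2) => //.
- exact: leq_ltn_trans n_lt.
- by move=> i R3 M3 [].
- move=> i R3 R4 M3 [h ag3 h3] ag4; split=> //.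
  + by apply: agree_trans ag3 ag4 _ _; lia.
  + by have [_ ->] := ag4.
move=> i R3 M3 ilt [hA3 ag3 h3] hv.
move: c2; rewrite /loop_code => /code_at_cat[_ /code_at_cat[c5 _]].
have hr3 : env_rel (rcons rho i) R3.
  apply: env_rel_push hv; first exact: env_rel_agree hr ag3.
  exact: ltn_trans ilt (leq_ltn_trans okn n_lt).
have e7 : size (rcons rho i) = (size rho).+1 by rewrite size_rcons.
have := IH (rcons rho i) t.+1 (off + size (expr_code (size rho) t off e) + 3) _ R3 M3.
rewrite e7 => {}IH.
apply: (computes_weaken (IH _ c5 hA3 hr3 (ok2 i ilt))) => // R4 M4 [hA4 ag4].
split; last by have [-> //] := ag4.
split=> //.
- by apply: agree_trans ag3 ag4 _ _; lia.
- by have [_ ->] := ag4.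
Qed.

End Compiler.

(** * Sorting the rows of one round *)

Section Lcp.
Variables (T : eqType).
Implicit Types f g : nat -> T.

(** Sequences are functions cut off at [k]. If no difference is found the value is [k], so agreement
    on all known columns needs no separate case. *)
Definition lcp f g k := find (fun q => f q != g q) (iota 0 k).

Lemma lcp_le f g k : lcp f g k <= k.
Proof. by rewrite -[leqRHS](size_iota 0) find_size. Qed.

Lemma lcp_eq f g k q : q < lcp f g k -> f q = g q.
Proof.
move=> h; have qk := leq_trans h (lcp_le f g k).
by have /negbT := before_find 0 h; rewrite nth_iota // negbK => /eqP.
Qed.

Lemma lcp_neq f g k : lcp f g k < k -> f (lcp f g k) <> g (lcp f g k).
Proof.
move=> h; have hs : has (fun q => f q != g q) (iota 0 k) by rewrite has_find size_iota.
by have := nth_find 0 hs; rewrite nth_iota // => /eqP.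
Qed.

Lemma lcp_unique f g k l :
  l <= k -> (forall q, q < l -> f q = g q) -> (l < k -> f l <> g l) ->
  lcp f g k = l.
Proof.
move=> lk h1 h2; case: (ltngtP (lcp f g k) l) => // h.
  by have := lcp_neq (leq_trans h lk); rewrite h1.
by have := h2 (leq_trans h (lcp_le f g k)); rewrite (lcp_eq h).
Qed.

Lemma lcpC f g k : lcp f g k = lcp g f k.
Proof.
apply: lcp_unique; first exact: lcp_le.
  by move=> q /lcp_eq.
by move=> /lcp_neq h e; apply: h.
Qed.

Lemma eq_lcp f g f' g' k :
  (forall q, q < k -> f q = f' q) -> (forall q, q < k -> g q = g' q) ->
  lcp f g k = lcp f' g' k.
Proof.
move=> hf hg; apply: lcp_unique; first exact: lcp_le.
  move=> q h; have qk := leq_trans h (lcp_le f' g' k).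
  by rewrite hf // hg // (lcp_eq h).
by move=> h; rewrite hf // hg //; exact: lcp_neq.
Qed.

End Lcp.

Section Lex.
Variables (ds : Order.disp_t) (Ss : finOrderType ds).
Implicit Types (x y z : ecode Ss) (X Y Z : seq (ecode Ss)).

Lemma ecode_ltxx x : ecode_lt x x = false.
Proof. by case: x => [s|k] /=; rewrite ?ltxx ?ltnn. Qed.

Lemma ecode_lt_trans x y z : ecode_lt x y -> ecode_lt y z -> ecode_lt x z.
Proof.
by case: x y z => [s|k] [s'|k'] [s''|k''] //=; [exact: lt_trans|exact: ltn_trans].
Qed.

Lemma ecode_lt_asym x y : ecode_lt x y -> ecode_lt y x = false.
Proof.
move=> h; apply/negP => h'.
by have := ecode_lt_trans h h'; rewrite ecode_ltxx.
Qed.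

Lemma ecode_lt_total x y : [|| ecode_lt x y, x == y | ecode_lt y x].
Proof.
case: x y => [s|k] [s'|k'] //=.
  by rewrite (inj_eq (@inl_inj _ _)); case: ltgtP.
by rewrite (inj_eq (@inr_inj _ _)); case: ltngtP.
Qed.

Lemma lex_le_refl : reflexive (@lex_le _ Ss).
Proof. by elim=> //= x X IH; rewrite eqxx IH orbT. Qed.

Lemma lex_le_trans : transitive (@lex_le _ Ss).
Proof.
elim=> [|y Y IH] [|x X] [|z Z] //=.
case/orP=> [xy|/andP[/eqP-> XY]] /orP[yz|/andP[/eqP<- YZ]].
- by rewrite (ecode_lt_trans xy yz).
- by rewrite xy.
- by rewrite yz.
- by rewrite eqxx (IH _ _ XY YZ) orbT.
Qed.

Lemma lex_le_anti : antisymmetric (@lex_le _ Ss).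
Proof.
elim=> [|x X IH] [|y Y] //= /andP[].
case/orP=> [xy|/andP[/eqP-> XY]].
  rewrite (ecode_lt_asym xy) /=; case: eqP => //= e.
  by rewrite e ecode_ltxx in xy.
by rewrite ecode_ltxx eqxx /= => YX; rewrite (IH Y) // XY YX.
Qed.

Lemma lex_le_total : total (@lex_le _ Ss).
Proof.
elim=> [|x X IH] [|y Y] //=.
have := ecode_lt_total x y; case: (ecode_lt x y) => //=.
case: eqP => [->|_] /=; last by move->.
by rewrite eqxx ecode_ltxx /=; case/orP: (IH Y) => ->; rewrite ?orbT.
Qed.

Lemma lex_le_take k X Y : lex_le X Y -> lex_le (take k X) (take k Y).
Proof.
elim: X Y k => [|x X IH] [|y Y] [|k] //=.
by case/orP=> [->//|/andP[-> /IH->]]; rewrite orbT.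
Qed.

Lemma mkseqS (T : Type) (f : nat -> T) k :
  mkseq f k.+1 = f 0 :: mkseq (fun q => f q.+1) k.
Proof. by rewrite /mkseq /= (iotaDl 1 0) -map_comp. Qed.

Lemma lex_lt_at (f g : nat -> ecode Ss) k m :
  m < k -> (forall q, q < m -> f q = g q) -> ecode_lt (f m) (g m) ->
  lex_le (mkseq f k) (mkseq g k) /\ lex_le (mkseq g k) (mkseq f k) = false.
Proof.
elim: k m f g => [|k IH] // [|m] f g mk hq hlt; rewrite !mkseqS /=.
  rewrite hlt (ecode_lt_asym hlt); split=> //=.
  by case: eqP => //= e; rewrite e ecode_ltxx in hlt.
rewrite hq // eqxx ecode_ltxx /=.
by apply: (IH m) => // q qm; apply: hq.
Qed.

Lemma lex_le_lcp (f g : nat -> ecode Ss) k :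
  lex_le (mkseq f k) (mkseq g k) -> lcp f g k < k ->
  ecode_lt (f (lcp f g k)) (g (lcp f g k)).
Proof.
move=> hle hl; have := ecode_lt_total (f (lcp f g k)) (g (lcp f g k)).
case/or3P=> // [/eqP|h]; first by move/(lcp_neq hl).
have [|_] := @lex_lt_at g f k _ hl _ h; last by rewrite hle.
by move=> q /lcp_eq.
Qed.

End Lex.

(** * Sorting by counting predecessors *)

Section Rank.
Variables (I : finType) (r : rel I).
Hypotheses (r_irr : irreflexive r) (r_trans : transitive r).
Hypothesis r_tot : forall x y, x != y -> r x y || r y x.

Definition rank x : nat := \sum_y r y x.

Lemma rank_mono x y : r x y -> rank x < rank y.
Proof.
move=> xy; rewrite /rank [ltnLHS](bigD1 x) //= [ltnRHS](bigD1 x) //=.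
rewrite r_irr xy ltnS; apply: leq_sum => z _.
by case zx: (r z x) => //; rewrite (r_trans zx xy).
Qed.

(** Counting predecessors is strictly monotone, and totality separates distinct elements. Together
    with the bound [#|I|] this makes the rank a permutation, that is, a sort expressed by sums
    only. *)
Lemma rank_inj : injective rank.
Proof.
move=> x y e; apply/eqP; case: (boolP (x == y)) => // /r_tot.
by case/orP=> /rank_mono; rewrite e ltnn.
Qed.

Lemma rank_lt x : rank x < #|I|.
Proof.
have -> : #|I| = \sum_(y : I) 1 by rewrite -sum1_card; apply: eq_bigl.
rewrite /rank [ltnLHS](bigD1 x) //= [ltnRHS](bigD1 x) //= r_irr add0n add1n ltnS.
by apply: leq_sum => i _; case: (r i x).
Qed.

End Rank.

(** Search by summation: a test that succeeds at exactly one index turns a sum into a lookup. *)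
Lemma sum_pick n (F : nat -> nat) (P : pred nat) i :
  i < n -> P i -> (forall j, j < n -> P j -> j = i) ->
  \sum_(j < n) F j * P j = F i.
Proof.
move=> il Pi u; rewrite (bigD1 (Ordinal il)) //= Pi muln1 big1 ?addn0 // => j ne.
case Pj: (P j); last by rewrite muln0.
by case/eqP: ne; apply: val_inj; exact: u (ltn_ord j) Pj.
Qed.

(* One round of the inversion, for rows [E i] that have been read up to column
   [k]: prepending [hd i] turns the entry at [piv i], if there is one, from a
   first occurrence into a repetition of the prepended symbol. *)
Section Resort.
Variables (ds : Order.disp_t) (Ss : finOrderType ds) (n : nat).
Variables (E : nat -> nat -> ecode Ss) (hd : nat -> ecode Ss) (piv : nat -> nat).
Hypothesis E_le : forall i q v, i < n -> q < n -> E i q = inr v -> v <= q.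
Hypothesis E_piv : forall i, i < n -> piv i < n -> E i (piv i) = inr 0.
Hypothesis E_sorted : forall i j k, i <= j -> j < n -> k <= n ->
  lex_le (mkseq (E i) k) (mkseq (E j) k).

(** The prepended symbol takes position 0 and column [q] moves to [q.+1], hence the new distance
    [q.+1]. *)
Definition bumped i q : ecode Ss := if q == piv i then inr q.+1 else E i q.

Definition prepended i q : ecode Ss := if q is q'.+1 then bumped i q' else hd i.

Hypothesis E_perm : forall k, k < n ->
  perm_eq [seq mkseq (prepended i) k.+1 | i <- iota 0 n]
          [seq mkseq (E a) k.+1 | a <- iota 0 n].

Variable k : nat.
Hypothesis k_lt : k < n.

(** A pivot that has not been read yet is represented by [k]: such a row is unchanged in the known
    columns, wherever its pivot may be. *)
Definition kpiv i := minn k (piv i).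

(** For i < j this is the case in which row [i] overtakes row [j]: its raised entry lies in the
    common prefix or just behind it, and is met before the pivot of row [j]. *)
Definition flips i j : bool :=
  (kpiv i < kpiv j) && (kpiv i <= lcp (E i) (E j) k).

(** Among equal heads the old order decides, unless the lower row overtakes the other; rows that tie
    keep their old order. *)
Definition before j i : bool :=
  ecode_lt (hd j) (hd i) ||
  (hd j == hd i) && (if j < i then ~~ flips j i else (i < j) && flips i j).

Lemma bumped_neq i q : piv i <> q -> bumped i q = E i q.
Proof. by move=> h; rewrite /bumped; case: eqP => // e; case: h. Qed.

Lemma bumped_piv i : bumped i (piv i) = inr (piv i).+1.
Proof. by rewrite /bumped eqxx. Qed.

(** A distance in column [q] cannot reach beyond the start of the row, so the raised entry beats
    whatever another row has in its column. All comparisons below rest on this. *)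
Lemma ecode_lt_bump i q : i < n -> q < n -> ecode_lt (E i q) (inr q.+1).
Proof. by move=> il ql; case e: (E i q) => [s|v] //=; rewrite ltnS (E_le il ql e). Qed.

(** At the earlier of two different capped pivots only one row receives [q.+1], which no unchanged
    entry of that column equals, so the common prefix ends there at the latest. With equal capped
    pivots both rows change in the same place, or neither changes in the known columns. *)
Lemma lcp_bumped i j : i < n -> j < n ->
  lcp (bumped i) (bumped j) k =
  if kpiv i == kpiv j then lcp (E i) (E j) k
  else minn (lcp (E i) (E j) k) (minn (kpiv i) (kpiv j)).
Proof.
wlog ij : i j / kpiv i <= kpiv j.
  move=> H il jl; case/orP: (leq_total (kpiv i) (kpiv j)) => h; first exact: H.
  by rewrite lcpC H // eq_sym [lcp (E j) _ _]lcpC [minn (kpiv j) _]minnC.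
move=> il jl; set l := lcp (E i) (E j) k.
have lk : l <= k := lcp_le _ _ _.
have heq q : q < l -> E i q = E j q by exact: lcp_eq.
case: eqP => [e|/eqP ne].
  have [[e1 pk]|[h1 h2]] : (piv i = piv j /\ piv i < k) \/ (k <= piv i /\ k <= piv j).
  - by move: e; rewrite /kpiv; lia.
  - apply: lcp_unique => // [q ql|lk'].
      by rewrite /bumped e1; case: eqP => // _; apply: heq.
    (* Both old entries at a common pivot are 0, so the first difference lies elsewhere and survives
       the change. *)
    have lp : piv i <> l.
      move=> lp; apply: (lcp_neq lk'); rewrite -/l -lp E_piv //; last lia.
      by rewrite e1 E_piv //; lia.
    by rewrite !bumped_neq // -?e1 //; exact: lcp_neq.
  - apply: lcp_unique => // [q ql|lk'].
      by rewrite !bumped_neq //; [apply: heq|lia|lia].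
    by rewrite !bumped_neq //; [exact: lcp_neq|lia|lia].
have {ij ne} [e1 pk pj] : [/\ kpiv i = piv i, piv i < k & piv i < piv j].
  by move: ij ne; rewrite /kpiv; split; lia.
have pij : piv i < kpiv j by rewrite /kpiv; lia.
have -> : minn l (minn (kpiv i) (kpiv j)) = minn l (piv i) by lia.
apply: lcp_unique; first lia.
  by move=> q ql; rewrite !bumped_neq //; [apply: heq|..]; lia.
move=> _; case: (ltngtP l (piv i)) => lp.
- rewrite !bumped_neq //; try lia.
  by apply: lcp_neq; rewrite -/l; lia.
- rewrite bumped_piv bumped_neq //; last lia.
  by rewrite -heq // E_piv //; lia.
rewrite lp bumped_piv bumped_neq //; last lia.
move=> e; have := @ecode_lt_bump j (piv i) jl; rewrite -e ecode_ltxx.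
by move=> h; have : false by apply: h; lia.
Qed.

Lemma lex_bumped i j : i < j -> j < n ->
  if flips i j then
    lex_le (mkseq (bumped j) k) (mkseq (bumped i) k) /\
    lex_le (mkseq (bumped i) k) (mkseq (bumped j) k) = false
  else lex_le (mkseq (bumped i) k) (mkseq (bumped j) k).
Proof.
move=> ij jl; have il := ltn_trans ij jl.
set l := lcp (E i) (E j) k.
have lk : l <= k := lcp_le _ _ _.
have heq q : q < l -> E i q = E j q by exact: lcp_eq.
have hlt : l < k -> ecode_lt (E i l) (E j l).
  by apply: lex_le_lcp; apply: E_sorted => //; exact: ltnW.
have hl := lcp_bumped il jl; rewrite -/l in hl.
have hb q : q < lcp (bumped i) (bumped j) k -> bumped i q = bumped j q by exact: lcp_eq.
rewrite /flips -/l; case: ifP => [/andP[h1 h2]|/negbT hf].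
  have [e1 pk pj] : [/\ kpiv i = piv i, piv i < k & piv i < piv j].
    by move: h1; rewrite /kpiv; split; lia.
  apply: (@lex_lt_at _ _ _ _ k (piv i)) => // [q qp|].
    by rewrite hb // hl ifF; lia.
  rewrite bumped_piv bumped_neq //; last lia.
  by apply: ecode_lt_bump => //; lia.
case: (ltnP (lcp (bumped i) (bumped j) k) k) => [hk|hk]; last first.
  have -> : mkseq (bumped i) k = mkseq (bumped j) k.
    apply/eq_in_map => q; rewrite mem_iota add0n => /andP[_ qk].
    by apply: hb; lia.
  exact: lex_le_refl.
suff h : ecode_lt (bumped i (lcp (bumped i) (bumped j) k))
                  (bumped j (lcp (bumped i) (bumped j) k)).
  by case: (lex_lt_at hk hb h).
have hnb := lcp_neq hk.
rewrite hl; rewrite hl in hk hnb; case: ifP hk hnb => [/eqP e|/negbT ne] hk hnb.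
  have := hlt hk.
  have [[e1 pk]|[g1 g2]] : (piv i = piv j /\ piv i < k) \/ (k <= piv i /\ k <= piv j).
  - by move: e; rewrite /kpiv; lia.
  - have lp : piv i <> l.
      by move=> lp; apply: hnb; rewrite -lp bumped_piv e1 bumped_piv.
    by rewrite !bumped_neq // -e1.
  - by rewrite !bumped_neq //; lia.
(* Without a flip, either the old difference comes before the pivot of row [i], or the earlier pivot
   belongs to row [j] and raising it confirms the old order. *)
case: (ltnP (kpiv i) (kpiv j)) => hij.
  have lp : l < kpiv i by move: hf; rewrite hij /= -ltnNge.
  have -> : minn l (kpiv i) = l by lia.
  rewrite !bumped_neq //; by move: lp hij; rewrite /kpiv; lia.
have [e1 pk pj] : [/\ kpiv j = piv j, piv j < k & piv j < piv i].
  by move: hij ne; rewrite /kpiv; split; lia.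
rewrite e1; case: (leqP l (piv j)) => lp; last first.
  rewrite bumped_piv bumped_neq //; last lia.
  by apply: ecode_lt_bump => //; lia.
case: (ltngtP l (piv j)) lp => // lp _.
  rewrite !bumped_neq //; lia.
rewrite lp bumped_piv bumped_neq //; last lia.
by apply: ecode_lt_bump => //; lia.
Qed.

(** Separating equal prefixes by the old index makes the order strict and total, so that ranks form
    a permutation even while many rows still agree. *)
Definition lex_before j i : bool :=
  let X := mkseq (prepended j) k.+1 in let Y := mkseq (prepended i) k.+1 in
  if X == Y then j < i else lex_le X Y.

Lemma before_lex j i : j < n -> i < n -> before j i = lex_before j i.
Proof.
move=> jl il; rewrite /before /lex_before !mkseqS /=.
have -> (f : nat -> ecode Ss) : mkseq (fun q => f q) k = mkseq f k by [].
rewrite eqseq_cons; case: (boolP (ecode_lt (hd j) (hd i))) => [h|h] /=.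
  by case: eqP => //= e; rewrite e ecode_ltxx in h.
case: eqP => [e|] //=.
set X := mkseq _ _; set Y := mkseq _ _.
case: (ltngtP j i) => ji.
- have := lex_bumped ji il; rewrite -/X -/Y; case: (flips j i).
    by case=> _ h2; case: eqP => [E12|_] /=; rewrite ?h2 //; rewrite E12 lex_le_refl in h2.
  by move=> -> /=; case: eqP.
- have := lex_bumped ji jl; rewrite -/X -/Y; case: (flips i j) => /=.
    by case=> h1 h2; case: eqP => [E12|_] //=; rewrite E12 lex_le_refl in h2.
  move=> hle; case: eqP => //= ne; apply/esym/negP => hle'; apply: ne.
  by apply: lex_le_anti; rewrite hle hle'.
- by subst i; rewrite eqxx.
Qed.

Definition new_row i := \sum_(j < n) before j i.
Definition old_row a := \sum_(i < n) i * (new_row i == a).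

Let r (i j : 'I_n) := lex_before i j.

Let r_irr : irreflexive r.
Proof. by move=> i; rewrite /r /lex_before eqxx ltnn. Qed.

Let r_trans : transitive r.
Proof.
move=> y x z; rewrite /r /lex_before.
move: (mkseq (prepended x) k.+1) (mkseq (prepended y) k.+1) => X Y.
move: (mkseq (prepended z) k.+1) => Z.
case: (eqVneq X Y) => [e1|xy].
  by subst Y; case: (eqVneq X Z) => [_|_] //; exact: ltn_trans.
case: (eqVneq Y Z) => [e2|yz]; first by subst Z; rewrite (negPf xy).
move=> h1 h2; case: eqP => [e|_]; last exact: lex_le_trans h2.
by case/eqP: xy; apply: lex_le_anti; rewrite h1 e.
Qed.

Let r_tot i j : i != j -> r i j || r j i.
Proof.
rewrite /r /lex_before => ij.
move: (mkseq (prepended i) k.+1) (mkseq (prepended j) k.+1) => X Y.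
case: (eqVneq X Y) => _; first by rewrite -neq_ltn.
exact: lex_le_total.
Qed.

Let new_rowE (i : 'I_n) : new_row i = rank r i.
Proof. by apply: eq_bigr => j _; rewrite before_lex. Qed.

Lemma old_row_spec a : a < n -> old_row a < n /\ new_row (old_row a) = a.
Proof.
move=> al; have rl i : rank r i < n by rewrite -[ltnRHS]card_ord rank_lt.
pose f (i : 'I_n) : 'I_n := Ordinal (rl i).
have fE (i : 'I_n) : f i = rank r i :> nat by [].
have f_inj : injective f.
  by move=> i j e; apply: (rank_inj r_irr r_trans r_tot); rewrite -!fE e.
have [g _ fg] := injF_bij f_inj.
have ga : new_row (g (Ordinal al)) = a by rewrite new_rowE -fE fg.
suff -> : old_row a = g (Ordinal al) by [].
apply: (@sum_pick n id (fun i => new_row i == a)) => //; first by apply/eqP.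
move=> j jl /eqP ja; have := congr1 val (f_inj (Ordinal jl) (g (Ordinal al)) _).
by apply; apply: val_inj; rewrite /= -!new_rowE ga.
Qed.

(** Both lists are sorted, the left one by the choice of [old_row], and [E_perm] makes them
    permutations of each other; a list has only one sorted arrangement under an antisymmetric order.
    Columns beyond [k] are out of reach, since a tie may be broken against what they contain. *)
Lemma prepended_old_row a q :
  a < n -> q <= k -> prepended (old_row a) q = E a q.
Proof.
suff H : [seq mkseq (prepended (old_row a)) k.+1 | a <- iota 0 n] =
         [seq mkseq (E a) k.+1 | a <- iota 0 n].
  move=> al qk; have := congr1 (fun s => nth (inr 0) (nth [::] s a) q) H.
  by rewrite !(nth_map 0) ?size_iota // !nth_iota // !nth_mkseq.
move=> {a q}.
apply: (sorted_eq (leT := @lex_le _ Ss) (@lex_le_trans _ Ss) (@lex_le_anti _ Ss)).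
- apply/(sortedP [::]) => a; rewrite size_map size_iota => al.
  rewrite !(nth_map 0) ?size_iota ?(ltnW al) // !nth_iota ?(ltnW al) // !add0n.
  have [o1 n1] := old_row_spec (ltnW al); have [o2 n2] := old_row_spec al.
  pose i := Ordinal o1; pose j := Ordinal o2.
  have ij : i != j.
    apply/eqP => /(congr1 val) /= e; have := n1; rewrite e n2; lia.
  case/orP: (r_tot ij) => h.
    move: h; rewrite /r /lex_before; case: eqP => [e _|//].
    by have := lex_le_refl (mkseq (prepended i) k.+1); rewrite {2}e.
  have := rank_mono r_irr r_trans (h : r j i).
  by rewrite -!new_rowE /= n1 n2; lia.
- apply/(sortedP [::]) => a; rewrite size_map size_iota => al.
  rewrite !(nth_map 0) ?size_iota ?(ltnW al) // !nth_iota ?(ltnW al) // !add0n.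
  by apply: E_sorted.
apply: perm_trans (E_perm k_lt).
rewrite (map_comp (fun i => mkseq (prepended i) k.+1) old_row); apply: perm_map.
have u : uniq [seq old_row a | a <- iota 0 n].
  rewrite map_inj_in_uniq ?iota_uniq // => a b.
  rewrite !mem_iota !add0n => /andP[_ al] /andP[_ bl] e.
  by have [_ <-] := old_row_spec al; have [_ <-] := old_row_spec bl; rewrite e.
apply: uniq_perm; rewrite ?iota_uniq //.
apply: (uniq_min_size u _ _).2; last by rewrite size_map.
move=> x /mapP[a]; rewrite !mem_iota !add0n => /andP[_ al] ->.
by case: (old_row_spec al).
Qed.

End Resort.

(** * Prev-encodings *)

Lemma max_ord_eq q (P : pred nat) m :
  m < q -> P m -> (forall j, m < j < q -> ~~ P j) ->
  \max_(j < q | P j) (j : nat) = m.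
Proof.
move=> mq Pm h; apply/eqP; rewrite eqn_leq; apply/andP; split.
  apply/bigmax_leqP => j Pj; rewrite leqNgt; apply/negP => mj.
  by have := h j; rewrite mj ltn_ord Pj => /(_ isT).
exact: (@leq_bigmax_cond _ (fun j : 'I_q => P j) (fun j : 'I_q => j : nat) (Ordinal mq)).
Qed.

Section PrevEnc.
Variables (ds dp : Order.disp_t) (Ss : finOrderType ds) (Sp : finOrderType dp).
Implicit Types (x w : seq (psym Ss Sp)) (c d : psym Ss Sp).

Lemma size_prev_enc w : size (prev_enc w) = size w.
Proof. by rewrite size_image card_ord. Qed.

Lemma nth_prev_enc e0 c0 w q :
  q < size w -> nth e0 (prev_enc w) q = prev_sym w q (nth c0 w q).
Proof.
move=> ql; rewrite /prev_enc (nth_map (Ordinal ql)) ?size_enum_ord //.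
rewrite (_ : nth _ _ q = Ordinal ql); last exact: (nth_ord_enum _ (Ordinal ql)).
by rewrite (tnth_nth c0).
Qed.

Lemma prev_sym_new x q (p : Sp) :
  inr p \notin take q x -> prev_sym x q (inr p) = inr 0.
Proof. by rewrite /prev_sym => /negPf->. Qed.

(** [prev_sym] reads with the symbol itself as default, so positions past the end look like
    occurrences of it. The second alternative accounts for them; it is excluded below by
    [q <= size x]. *)
Lemma last_occurrence x q d :
  d \in take q x ->
  exists m, [/\ m < q, m < size x, nth d x m = d
              & forall j, m < j < q -> nth d x j != d \/ size x <= j].
Proof.
move=> dx; have ex : exists m, (m < minn q (size x)) && (nth d x m == d).
  exists (index d x); have := index_mem d (take q x); rewrite dx size_take => h.
  have dx' : d \in x by exact: mem_take dx.
  by rewrite nth_index // eqxx andbT leq_min index_mem dx' -in_take // dx.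
have ub m : (m < minn q (size x)) && (nth d x m == d) -> m <= q by lia.
case: (ex_maxnP ex ub) => m /andP[]; rewrite leq_min => /andP[mq mx] /eqP me mm.
exists m; split=> // j /andP[mj jq]; case: (leqP (size x) j) => jx; [by right|left].
by apply/negP => e; have := mm j; rewrite leq_min jq jx e => /(_ isT); lia.
Qed.

Lemma prev_sym_old x q (p : Sp) :
  q <= size x -> inr p \in take q x ->
  exists m, [/\ m < q, nth (inr p) x m = inr p,
     forall j, m < j < q -> nth (inr p) x j != inr p
   & prev_sym x q (inr p) = inr (q - m)].
Proof.
move=> qx h; have [m [mq mx me mm]] := last_occurrence h.
have mm' j : m < j < q -> nth (inr p) x j != inr p.
  by move=> jb; case: (mm j jb) => // ?; lia.
exists m; split=> //; rewrite /prev_sym h.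
by rewrite (@max_ord_eq q (fun j => nth (inr p) x j == inr p) m) //; apply/eqP.
Qed.

Lemma prev_sym_le x q d v : q <= size x -> prev_sym x q d = inr v -> v <= q.
Proof.
case: d => [s|p] // qx; case: (boolP (inr p \in take q x)) => h.
  by case: (prev_sym_old qx h) => m [_ _ _ ->] [<-]; exact: leq_subr.
by rewrite prev_sym_new // => -[<-].
Qed.

Lemma prev_sym_eq0 x q d : q <= size x ->
  (prev_sym x q d == inr 0) = if d is inr p then inr p \notin take q x else false.
Proof.
case: d => [s|p] // qx; case: (boolP (inr p \in take q x)) => h.
  case: (prev_sym_old qx h) => m [mq _ _ ->]; apply/negP => /eqP [e]; lia.
by rewrite prev_sym_new // eqxx.
Qed.

Lemma prev_sym_back x q d v : q <= size x ->
  prev_sym x q d = inr v -> 0 < v -> v <= q /\ nth d x (q - v) = d.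
Proof.
case: d => [s|p] // qx; case: (boolP (inr p \in take q x)) => h.
  case: (prev_sym_old qx h) => m [mq e _ ->] [<-] _; split; first exact: leq_subr.
  by rewrite subKn // ltnW.
by rewrite prev_sym_new // => -[<-].
Qed.

Lemma prev_sym_eq_prefix x x' q d :
  q <= size x -> q <= size x' -> take q x = take q x' ->
  prev_sym x q d = prev_sym x' q d.
Proof.
case: d => [s|p] // qx qx' e; rewrite /prev_sym e.
case: ifP => // _; congr (inr (_ - _)); apply: eq_bigl => j.
by rewrite -(nth_take _ (ltn_ord j)) e nth_take.
Qed.

Lemma prev_enc_take k w : prev_enc (take k w) = take k (prev_enc w).
Proof.
case: (leqP (size w) k) => kw; first by rewrite !take_oversize ?size_prev_enc.
have ks : size (take k w) = k by rewrite size_take kw.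
apply: (@eq_from_nth _ (inr 0)).
  by rewrite size_prev_enc !size_take size_prev_enc.
move=> q; rewrite size_prev_enc ks => qk.
case: w kw ks => [|c0 w'] // ; set w := c0 :: w' => kw ks.
rewrite (nth_prev_enc _ c0) ?ks // !nth_take //.
rewrite (nth_prev_enc _ c0) ?(ltn_trans qk kw) //.
apply: prev_sym_eq_prefix; rewrite ?ks; try lia.
by rewrite take_takel // ltnW.
Qed.

(** Only the first occurrence of [c] sees the new symbol: every later one has a closer predecessor,
    and distances are invariant under the shift by one. *)
Lemma prev_sym_cons c x q d : q < size x -> nth c x q = d ->
  prev_sym (c :: x) q.+1 d =
  if (d == c) && (d \notin take q x) && (if d is inr _ then true else false)
  then inr q.+1 else prev_sym x q d.
Proof.
move=> qx dq; case: d dq => [s|p] dq; first by rewrite andbF.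
rewrite andbT [LHS]/prev_sym take_cons inE.
case: (boolP (inr p \in take q x)) => h.
  rewrite andbF orbT; have [m [mq me mm ->]] := prev_sym_old (ltnW qx) h.
  rewrite (@max_ord_eq q.+1 (fun j => nth (inr p) (c :: x) j == inr p) m.+1) ?subSS //=.
    exact/eqP.
  by case=> // j /=; rewrite !ltnS => /mm.
rewrite andbT orbF prev_sym_new //; case: eqP => [e|_] //.
rewrite (@max_ord_eq q.+1 (fun j => nth (inr p) (c :: x) j == inr p) 0) ?subn0 //=.
  by rewrite e.
case=> // j /=; rewrite ltnS => jq; apply/negP => /eqP e'.
case/negP: h; rewrite -{1}e' -(nth_take (n0 := q)) //.
by rewrite mem_nth // size_take qx; move: jq; lia.
Qed.

(** [pivot] is an index in the whole row, last symbol included, while prepending works on [x]. If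
    [c] does not occur in [x], the index is [size x] and no [q] qualifies. *)
Lemma index_rcons_last x c q :
  q < size x -> (q == index c (rcons x c)) = (nth c x q == c) && (c \notin take q x).
Proof.
move=> qx; rewrite -cats1 index_cat; apply/eqP/andP => [|[/eqP e n]].
  case: ifP => [cx|_]; last by rewrite /= eqxx addn0 => e; move: qx; rewrite e ltnn.
  by move=> ->; rewrite nth_index // eqxx in_take // ltnn.
have cx : c \in x by rewrite -e mem_nth.
rewrite cx; move: n; rewrite in_take // -leqNgt => n.
by apply/eqP; rewrite eqn_leq n /= -{1}e index_nth.
Qed.

End PrevEnc.

(** * The rows of the pBWT matrix *)

Lemma mkseq_take (T : Type) (x0 : T) (s : seq T) k :
  k <= size s -> mkseq (nth x0 s) k = take k s.
Proof.
move=> ks; apply: (@eq_from_nth _ x0); rewrite size_mkseq ?size_takel // => i ik.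
by rewrite nth_mkseq // nth_take.
Qed.

Lemma sum_ltn k m : \sum_(q < k) (q < m) = minn k m.
Proof.
elim: k => [|k IH]; first by rewrite big_ord0 min0n.
by rewrite big_ord_recr /= IH; lia.
Qed.

Lemma sum_eqn k (m : nat) : \sum_(q < k) (m == q :> nat) = (m < k).
Proof.
elim: k => [|k IH]; first by rewrite big_ord0 ltn0.
by rewrite big_ord_recr /= IH; lia.
Qed.

Lemma leq_sum_nat (F : nat -> nat) m k :
  m <= k -> \sum_(j < m) F j <= \sum_(j < k) F j.
Proof.
move=> mk; rewrite -!(big_mkord xpredT F) [leqRHS](big_cat_nat (leq0n m) mk).
exact: leq_addr.
Qed.

Section Rows.
Variables (ds dp : Order.disp_t) (Ss : finOrderType ds) (Sp : finOrderType dp).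
Variables (dollar : Ss) (n : nat) (T : seq (psym Ss Sp)).
Hypotheses (n_gt0 : 0 < n) (size_T : size T = n).
Hypothesis T_dollar : forall q, q < n ->
  (nth (inl dollar) T q == inl dollar) = (q.+1 == n).

Notation c0 := (inl dollar : psym Ss Sp).
Notation tau := (rot_order T).

Definition row i := rot (nth 0 tau i) T.
Definition enc i q : ecode Ss := nth (inr 0) (prev_enc (row i)) q.
Definition lastc i := last c0 (row i).
Definition fcode i : ecode Ss := if lastc i is inl s then inl s else inr 0.
(** The value n for a static symbol lies outside all columns. A p-symbol that occurs only at the end
    has pivot n - 1, its own column, which the rotation drops. *)
Definition pivot i := if lastc i is inl _ then n else index (lastc i) (row i).
Definition zeros_upto i q := \sum_(j < q.+1) (enc i j == inr 0).

Lemma size_row i : size (row i) = n.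
Proof. by rewrite size_rot size_T. Qed.

Lemma size_tau : size tau = n.
Proof. by rewrite size_sort size_iota. Qed.

Lemma perm_tau : perm_eq tau (iota 0 n).
Proof. by rewrite perm_sort size_T. Qed.

Lemma row_rcons i : exists2 x, row i = rcons x (lastc i) & size x = n.-1.
Proof.
rewrite /lastc; have := size_row i; case: (lastP (row i)) => [|x c].
  by move=> e; move: (n_gt0); rewrite -e.
by rewrite last_rcons size_rcons => e; exists x => //; rewrite -e.
Qed.

Lemma encE i q : q < n -> enc i q = prev_sym (row i) q (nth c0 (row i) q).
Proof. by move=> ql; rewrite /enc (nth_prev_enc _ c0) // size_row. Qed.

Lemma enc_take i k : k <= n -> mkseq (enc i) k = take k (prev_enc (row i)).
Proof. by move=> kn; apply: mkseq_take; rewrite size_prev_enc size_row. Qed.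

Lemma enc_le i q v : i < n -> q < n -> enc i q = inr v -> v <= q.
Proof.
by move=> il ql; rewrite encE //; apply: prev_sym_le; rewrite size_row ltnW.
Qed.

Lemma lastc_in i : lastc i \in row i.
Proof. by case: (row_rcons i) => x -> _; rewrite mem_rcons inE eqxx. Qed.

Lemma enc_pivot i : i < n -> pivot i < n -> enc i (pivot i) = inr 0.
Proof.
rewrite /pivot => il; have li := lastc_in i; case: (lastc i) li => [s|p] li.
  by rewrite ltnn.
move=> h; rewrite encE // nth_index //.
by apply: prev_sym_new; rewrite in_take // ltnn.
Qed.

Lemma enc_sorted i j k : i <= j -> j < n -> k <= n ->
  lex_le (mkseq (enc i) k) (mkseq (enc j) k).
Proof.
move=> ij jl kn; rewrite !enc_take //; apply: lex_le_take; rewrite /row.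
pose R i j := lex_le (prev_enc (rot i T)) (prev_enc (rot j T)).
have Rs : sorted R tau by apply: sort_sorted => x y; exact: lex_le_total.
apply: (@sorted_leq_nth _ R _ _ 0 _ Rs) => //; rewrite ?inE ?size_tau //.
- by move=> y x z; exact: lex_le_trans.
- by move=> x; exact: lex_le_refl.
- exact: leq_ltn_trans ij jl.
Qed.

(** Rotating right prepends the last symbol and drops it at the end; the drop does not affect the
    entries before it. *)
Lemma prepended_rotr i k : k < n ->
  mkseq (prepended enc fcode pivot i) k.+1 = take k.+1 (prev_enc (rotr 1 (row i))).
Proof.
move=> kn; have [x e sx] := row_rcons i.
apply: (@eq_from_nth _ (inr 0)).
  rewrite size_mkseq size_takel // size_prev_enc size_rotr size_row //.
move=> q; rewrite size_mkseq => qk; rewrite nth_mkseq // nth_take //.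
rewrite (nth_prev_enc _ c0) ?size_rotr ?size_row; last exact: leq_trans kn.
rewrite e rotr1_rcons; case: q qk => [|q] qk /=.
  by rewrite /fcode; case: (lastc i).
have qx : q < size x by lia.
have qn : q < n by lia.
rewrite (prev_sym_cons (c := lastc i) (x := x)) //; last exact: set_nth_default.
rewrite /bumped /pivot encE // e nth_rcons qx.
set d := nth c0 x q.
have dE : nth (lastc i) x q = d by exact: set_nth_default.
rewrite -(@prev_sym_eq_prefix _ _ _ _ (rcons x (lastc i)) x); last first.
- by rewrite -cats1 takel_cat // ltnW.
- exact: ltnW.
- by rewrite size_rcons ltnW // ltnW.
case E: (lastc i) => [s|p].
  rewrite ifF; last by apply/eqP => qe; lia.
  rewrite ifF //; apply/negP => /andP[/andP[/eqP->]]; by [].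
rewrite -E index_rcons_last // dE; case: (d =P lastc i) => [->|] //=.
by rewrite E andbT.
Qed.

(** The right rotation shifts the list of all rotations cyclically, so the prepended rows are the
    wanted rows in another order, with the same multiplicities. *)
Lemma enc_perm k : k < n ->
  perm_eq [seq mkseq (prepended enc fcode pivot i) k.+1 | i <- iota 0 n]
          [seq mkseq (enc a) k.+1 | a <- iota 0 n].
Proof.
move=> kn; pose g t := take k.+1 (prev_enc (rot t T)).
pose g' t := take k.+1 (prev_enc (rotr 1 (rot t T))).
have iotaE (h : nat -> seq (ecode Ss)) :
    [seq h (nth 0 tau i) | i <- iota 0 n] = map h tau.
  by rewrite (map_comp h (nth 0 tau)) -{1}size_tau -/(mkseq _ _) mkseq_nth.
have -> : [seq mkseq (prepended enc fcode pivot i) k.+1 | i <- iota 0 n] = map g' tau.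
  by rewrite -iotaE; apply: eq_map => i; rewrite prepended_rotr.
have -> : [seq mkseq (enc a) k.+1 | a <- iota 0 n] = map g tau.
  by rewrite -iotaE; apply: eq_map => i; rewrite enc_take.
apply: (@perm_trans _ (map g' (iota 0 n))); first exact/perm_map/perm_tau.
apply: (@perm_trans _ (map g (iota 0 n))); last first.
  by rewrite perm_sym; exact/perm_map/perm_tau.
case: (n) n_gt0 size_T => // m _ sT.
(* Rotation t + 1 turned right is rotation t, and rotation 0 turned right is rotation m, as n is
   [m.+1] here. *)
have -> : map g' (iota 0 m.+1) = g m :: map g (iota 0 m).
  rewrite /= (iotaDl 1 0) -map_comp; congr (_ :: _).
    by rewrite /g' /g rot0 /rotr sT subn1.
  apply/eq_in_map => t; rewrite mem_iota add0n /= => tm.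
  by rewrite /g' /g add1n rotS ?rotK // sT ltnW.
rewrite -addn1 iotaD map_cat add0n perm_sym perm_catC.
exact: perm_refl.
Qed.

Lemma zeros_take (X : seq (ecode Ss)) m : m <= size X ->
  zeros (take m X) = \sum_(j < m) (nth (inr 0) X j == inr 0).
Proof.
move=> mX; rewrite -(mkseq_take (inr 0) mX) /zeros count_map -sum1_count.
by rewrite big_mkcond /= -[m in iota _ m]subn0 -/(index_iota 0 m) big_mkord.
Qed.

Lemma pbwt_nth i : i < n ->
  nth (inr 0) (pbwt c0 T) i =
  if lastc i is inl s then inl s else inr (zeros_upto i (pivot i)).
Proof.
move=> il; rewrite (nth_map 0) ?size_tau //= -/(row i) -/(lastc i).
rewrite /pivot; have := lastc_in i; case E: (lastc i) => [s|p] //= li.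
rewrite prev_enc_take zeros_take // size_prev_enc.
by rewrite -[size _]/(size (row i)) index_mem.
Qed.

Lemma zeros_upto_le i q : zeros_upto i q <= q.+1.
Proof.
rewrite /zeros_upto -[leqRHS]card_ord -sum1_card.
by apply: leq_sum => j _; case: (_ == _).
Qed.

(** The count of zeros never decreases along a row and first reaches [C] at the pivot, itself a
    zero, so the columns with a smaller count are those before the pivot. For a static symbol n + 1
    exceeds every count, and all [k] columns are counted. *)
Lemma kpiv_sum i k (C : nat) : i < n -> k <= n ->
  C = (if lastc i is inl _ then n.+1 else zeros_upto i (pivot i)) ->
  \sum_(q < k) (zeros_upto i q < C) = kpiv pivot k i.
Proof.
move=> il kn CE; rewrite /kpiv -sum_ltn; apply: eq_bigr => q _; congr (nat_of_bool _).
have qn := leq_trans (ltn_ord q) kn; rewrite {}CE.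
have := @enc_pivot i il; rewrite /pivot; have li := lastc_in i.
case: (lastc i) li => [s|p] li; first by rewrite qn ltnS (leq_trans (zeros_upto_le _ _)).
have -> : index (inr p) (row i) < n by rewrite -(size_row i) index_mem.
move=> /(_ isT) ep; rewrite /zeros_upto; case: (ltnP q) => h.
  rewrite [ltnRHS]big_ord_recr /= ep eqxx addn1 ltnS.
  exact: (@leq_sum_nat (fun j => enc i j == inr 0 : nat)).
apply/negbTE; rewrite -leqNgt.
exact: (@leq_sum_nat (fun j => enc i j == inr 0 : nat)).
Qed.

(** * The row of T itself and the numbering of its p-symbols *)

Definition start := index 0 tau.

Lemma start_lt : start < n.
Proof. by rewrite -size_tau index_mem (perm_mem perm_tau) mem_iota. Qed.

Lemma row_start : row start = T.
Proof.
by rewrite /row nth_index ?rot0 // -index_mem size_tau start_lt.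
Qed.

Lemma fcode_start i : i < n -> (fcode i == inl dollar) = (i == start).
Proof.
move=> il; have tl : nth 0 tau i < n.
  have : nth 0 tau i \in tau by rewrite mem_nth ?size_tau.
  by rewrite (perm_mem perm_tau) mem_iota.
have -> : (i == start) = (nth 0 tau i == 0).
  rewrite -[X in _ = (_ == X)](@nth_index _ 0 0 tau); last first.
    by rewrite -index_mem size_tau start_lt.
  by rewrite nth_uniq ?size_tau ?start_lt // (perm_uniq perm_tau) iota_uniq.
have -> : (fcode i == inl dollar) = (lastc i == inl dollar).
  by rewrite /fcode; case: (lastc i).
rewrite /lastc /row; move: (nth 0 tau i) tl => [|t] tl.
  by rewrite rot0 -nth_last size_T T_dollar; lia.
rewrite /rot last_cat -nth_last size_take size_T tl.
rewrite (set_nth_default c0) ?size_take ?size_T ?tl //.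
by rewrite nth_take // T_dollar //; lia.
Qed.

(** Order of first occurrence. Symbols absent from [T] all have index [size T]; comparing them in
    the alphabet makes the order total, so that the renaming is a bijection of all of [Sp], as
    [pmatch] demands. *)
Definition name_before (c c' : Sp) : bool :=
  let i := index (inr c) T in let i' := index (inr c') T in
  (i < i') || (i == i') && (c < c')%O.

Lemma name_before_irr : irreflexive name_before.
Proof. by move=> c; rewrite /name_before ltnn ltxx andbF. Qed.

Lemma name_before_trans : transitive name_before.
Proof.
move=> y x z; rewrite /name_before.
case: (ltngtP (index (inr x) T) (index (inr y) T)) => //= h1.
  by case: (ltngtP (index (inr y) T) (index (inr z) T)) => //= h2; lia.
rewrite h1; case: (ltngtP (index (inr y) T) (index (inr z) T)) => //= h2.
exact: lt_trans.
Qed.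

Lemma name_before_tot x y : x != y -> name_before x y || name_before y x.
Proof.
rewrite /name_before; case: (ltngtP (index (inr x) T) (index (inr y) T)) => //= _.
by rewrite neq_lt.
Qed.

Lemma name_lt c : rank name_before c < #|Sp|.
Proof. exact: rank_lt name_before_irr c. Qed.

Definition rename (c : Sp) : Sp := Order.enum_val (Ordinal (name_lt c)).

Lemma enum_rank_rename c : Order.enum_rank (rename c) = rank name_before c :> nat.
Proof. by rewrite /rename Order.enum_valK. Qed.

Lemma rename_bij : bijective rename.
Proof.
apply: injF_bij => c c' e.
apply: (rank_inj name_before_irr name_before_trans name_before_tot).
by rewrite -!enum_rank_rename e.
Qed.

(** Each 0 is the first occurrence of exactly one p-symbol. The sum over the alphabet prepares the
    exchange of summations in [rename_new]. *)
Lemma enc_eq0 q : q < n ->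
  (enc start q == inr 0) = \sum_(c : Sp) (index (inr c) T == q) :> nat.
Proof.
move=> ql; rewrite encE // row_start prev_sym_eq0 ?size_T 1?ltnW //.
have eqT c : (index (inr c) T == q) -> nth c0 T q = inr c.
  by move=> /eqP e; rewrite -e nth_index // -index_mem size_T e.
case E: (nth c0 T q) => [s|p].
  rewrite big1 // => c _; case: eqP => // /eqP /eqT; by rewrite E.
have pT : inr p \in T by rewrite -E mem_nth // size_T.
rewrite (bigD1 p) //= big1 ?addn0 => [|c cp].
  rewrite in_take // -leqNgt eqn_leq andbC; congr (nat_of_bool _).
  by rewrite (_ : index _ _ <= q) ?andbT // -E index_nth ?size_T.
case: eqP => // /eqP /eqT; rewrite E => -[e].
by rewrite e eqxx in cp.
Qed.

(** The zeros before a first occurrence count the p-symbols that occur earlier, which is the rank of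
    the symbol; the subtracted 1 is its own zero. *)
Lemma rename_new q c : q < n -> nth c0 T q = inr c -> enc start q = inr 0 ->
  Order.enum_rank (rename c) = zeros_upto start q - 1 :> nat.
Proof.
move=> ql Tq e0; rewrite enum_rank_rename /zeros_upto big_ord_recr /= e0 eqxx addnK.
have idx : index (inr c) T = q.
  have cT : inr c \in T by rewrite -Tq mem_nth // size_T.
  move/eqP: e0; rewrite encE // row_start prev_sym_eq0 ?size_T 1?ltnW // Tq.
  rewrite in_take // -leqNgt => h; apply/eqP; rewrite eqn_leq h andbT.
  by rewrite -Tq index_nth ?size_T.
rewrite (eq_bigr (fun j : 'I_q => \sum_(c' : Sp) (index (inr c') T == j))); last first.
  by move=> j _; rewrite enc_eq0 // (ltn_trans (ltn_ord j)).
rewrite exchange_big /=; apply: eq_bigr => c' _.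
rewrite sum_eqn /name_before idx; case: (ltngtP _ q) => //= e.
suff -> : c' = c by rewrite ltxx.
have : nth c0 T (index (inr c') T) = inr c by rewrite e.
by rewrite nth_index => [[]|] //; rewrite -index_mem size_T e.
Qed.

Lemma enc_back q v : q < n -> enc start q = inr v -> 0 < v ->
  v <= q /\ nth c0 T (q - v) = nth c0 T q.
Proof.
move=> ql; rewrite encE // row_start => h v0.
have [|vq e] := prev_sym_back _ h v0; first by rewrite size_T ltnW.
by split=> //; rewrite -[RHS]e; apply: set_nth_default; rewrite size_T; lia.
Qed.

Lemma enc_static q s : q < n -> (enc start q = inl s <-> nth c0 T q = inl s).
Proof.
move=> ql; rewrite encE // row_start.
case: (nth c0 T q) => [s'|p]; first by split=> -[->].
by rewrite /prev_sym; case: ifP.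
Qed.

End Rows.

(** * Array comprehensions *)

Fixpoint reads (f : nat) (e : expr) : bool :=
  match e with
  | EVar _ | ECst _ => false
  | EBin _ e1 e2 | ESum e1 e2 => reads f e1 || reads f e2
  | ECell f' e1 e2 => [|| f' == f, reads f e1 | reads f e2]
  | EIf e1 e2 e3 => [|| reads f e1, reads f e2 | reads f e3]
  end.

Definition same_but (f : nat) (A A' : store) : Prop :=
  forall f' i j, f' != f -> A' f' i j = A f' i j.

Lemma ev_frame f A A' rho e :
  same_but f A A' -> ~~ reads f e -> ev rho A' e = ev rho A e.
Proof.
move=> h; elim: e rho => [x|c|o e1 IH1 e2 IH2|f' e1 IH1 e2 IH2|e1 IH1 e2 IH2 e3 IH3|e1 IH1 e2 IH2] rho //=;
  rewrite ?negb_or.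
- by case/andP=> h1 h2; rewrite IH1 // IH2.
- by case/and3P=> ff h1 h2; rewrite IH1 // IH2 // h.
- by case/and3P=> h1 h2 h3; rewrite IH1 // IH2 // IH3.
- case/andP=> h1 h2; rewrite IH1 //; apply: eq_bigr => i _; exact: IH2.
Qed.

Lemma expr_ok_frame n B f A A' rho e :
  same_but f A A' -> ~~ reads f e -> expr_ok n B rho A e -> expr_ok n B rho A' e.
Proof.
move=> h; elim: e rho => [x|c|o e1 IH1 e2 IH2|f' e1 IH1 e2 IH2|e1 IH1 e2 IH2 e3 IH3|e1 IH1 e2 IH2] rho //=;
  rewrite ?negb_or.
- case/andP=> h1 h2 [o1 o2 o3]; rewrite !(ev_frame _ h) //.
  by split=> //; [exact: IH1|exact: IH2].
- case/and3P=> ff h1 h2 [o1 o2 o3]; rewrite !(ev_frame _ h) //.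
  by split=> //; [exact: IH1|exact: IH2].
- case/and3P=> h1 h2 h3 [o1 o2 o3]; rewrite !(ev_frame _ h) //.
  by split=> [|/o2|/o3]; [exact: IH1|exact: IH2|exact: IH3].
- case/andP=> h1 h2 [o1 o2 o3 o4]; rewrite !(ev_frame _ h) //.
  split=> // [|i /o3|]; [exact: IH1|exact: IH2|].
  by rewrite (eq_bigr (fun i : 'I__ => ev (rcons rho i) A e2)) // => i _; rewrite (ev_frame _ h).
Qed.

(** If [e] does not read field [f], every entry is computed from the store before the loop, so the
    loop acts as a simultaneous assignment. The level [v] has to be the number of variables in
    scope. *)
Definition fill1 (v f : nat) (b e : expr) : stmt :=
  SFor b (SStore f (EVar v) (ECst 0) e).

Definition fill2 (v f : nat) (b1 b2 e : expr) : stmt :=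
  SFor b1 (SFor b2 (SStore f (EVar v) (EVar v.+1) e)).

Section Fill.
Variables (n B : nat).
Hypothesis B_gt0 : 0 < B.

Lemma iteri_fill1 rho f e A m :
  ~~ reads f e -> forall f' i j,
  iteri m (fun i => sem (rcons rho i) (SStore f (EVar (size rho)) (ECst 0) e)) A f' i j =
  if [&& f' == f, i < m & j == 0] then ev (rcons rho i) A e else A f' i j.
Proof.
move=> re; elim: m => [|m IH] f' i j; first by rewrite ltn0 andbF.
rewrite iteriS; set it := iteri m _ _; rewrite [sem _ _ _]/=.
have sb : same_but f A it by move=> g i' j' /negPf gf; rewrite /it IH gf.
rewrite !(ev_frame _ sb) //= nth_rcons ltnn eqxx /set_cell /it IH.
case: (f' =P f) => // _; case: (i =P m) => [->|ne].
  by rewrite ltnSn ltnn; case: (j == 0).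
by have -> : (i < m.+1) = (i < m) by lia.
Qed.

Lemma fill1_spec rho f b e A :
  ~~ reads f e -> expr_ok n B rho A b -> ev rho A b <= n ->
  (forall i, i < ev rho A b -> expr_ok n B (rcons rho i) A e) ->
  (forall i, i < ev rho A b -> cell_valid n f i 0) ->
  stmt_ok n B rho A (fill1 (size rho) f b e) /\
  forall f' i j, sem rho (fill1 (size rho) f b e) A f' i j =
    if [&& f' == f, i < ev rho A b & j == 0] then ev (rcons rho i) A e
    else A f' i j.
Proof.
move=> re okb bn oke val; split; last by move=> *; exact: iteri_fill1.
split=> // i il; have sb : same_but f A (iteri i (fun i => sem (rcons rho i) (SStore f (EVar (size rho)) (ECst 0) e)) A).
  by move=> g i' j' /negPf gf; rewrite iteri_fill1 // gf.
split=> //=; rewrite ?size_rcons // ?nth_rcons ?ltnn ?eqxx; last exact: val.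
by apply: expr_ok_frame sb re _; exact: oke.
Qed.

Lemma iteri_fill2_row rho f b e A m i0 :
  ~~ reads f e -> size rho = b -> forall f' i j,
  iteri m (fun j => sem (rcons (rcons rho i0) j)
             (SStore f (EVar b) (EVar b.+1) e)) A f' i j =
  if [&& f' == f, i == i0 & j < m] then ev (rcons (rcons rho i0) j) A e
  else A f' i j.
Proof.
move=> re <-; elim: m => [|m IH] f' i j; first by rewrite ltn0 !andbF.
rewrite iteriS; set it := iteri m _ _; rewrite [sem _ _ _]/= /set_cell.
have sb : same_but f A it by move=> g i' j' /negPf gf; rewrite /it IH gf.
rewrite !(ev_frame _ sb) // /it IH !nth_rcons !size_rcons ltnSn !ltnn !eqxx.
case: (f' =P f) => //= _; case: (i =P i0) => //= _.
case: (j =P m) => [->|ne]; first by rewrite ltnSn.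
by have -> : (j < m.+1) = (j < m) by lia.
Qed.

Lemma iteri_fill2 rho f b2 bv e A m :
  ~~ reads f e -> ~~ reads f b2 ->
  (forall i, ev (rcons rho i) A b2 = bv) -> forall f' i j,
  iteri m (fun i => sem (rcons rho i)
     (SFor b2 (SStore f (EVar (size rho)) (EVar (size rho).+1) e))) A f' i j =
  if [&& f' == f, i < m & j < bv] then ev (rcons (rcons rho i) j) A e
  else A f' i j.
Proof.
move=> re rb hb; elim: m => [|m IH] f' i j; first by rewrite ltn0 !andbF.
rewrite iteriS; set it := iteri m _ _; rewrite [sem _ _ _]/=.
have sb : same_but f A it by move=> g i' j' /negPf gf; rewrite /it IH gf.
rewrite (ev_frame _ sb) // hb (iteri_fill2_row _ _ _ re) // (ev_frame _ sb) // /it IH.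
case: (f' =P f) => // _; case: (i =P m) => [->|ne].
  by rewrite ltnSn ltnn; case: (j < bv).
by have -> : (i < m.+1) = (i < m) by lia.
Qed.

Lemma fill2_spec rho f b1 b2 bv e A :
  ~~ reads f e -> ~~ reads f b2 -> expr_ok n B rho A b1 -> ev rho A b1 <= n ->
  (forall i, ev (rcons rho i) A b2 = bv) ->
  (forall i, expr_ok n B (rcons rho i) A b2) -> bv <= n ->
  (forall i j, i < ev rho A b1 -> j < bv ->
     expr_ok n B (rcons (rcons rho i) j) A e) ->
  (forall i j, i < ev rho A b1 -> j < bv -> cell_valid n f i j) ->
  stmt_ok n B rho A (fill2 (size rho) f b1 b2 e) /\
  forall f' i j, sem rho (fill2 (size rho) f b1 b2 e) A f' i j =
    if [&& f' == f, i < ev rho A b1 & j < bv] then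
      ev (rcons (rcons rho i) j) A e
    else A f' i j.
Proof.
move=> re rb okb bn hb okb2 bvn oke val; split; last by move=> *; exact: iteri_fill2.
split=> // i il; set it := iteri i _ _.
have sb : same_but f A it.
  by move=> g i' j' /negPf gf; rewrite /it (iteri_fill2 _ _ _ hb) // gf.
split; rewrite ?(ev_frame _ sb) ?hb //; first exact: expr_ok_frame sb rb _.
move=> j jl; set jt := iteri j _ _.
have sb' : same_but f A jt.
  move=> g i' j' gf; rewrite -(sb g i' j' gf) /jt iteri_fill2_row // (negPf gf) //.
split=> /=; rewrite ?size_rcons // ?nth_rcons ?size_rcons ?ltnSn ?ltnn ?eqxx //.
  by apply: expr_ok_frame sb' re _; exact: oke.
exact: val.
Qed.

End Fill.

Section Evals.
Variables (n B : nat).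
Hypothesis B_gt1 : 1 < B.

(** Safety and value are derived together, since the bounds that safety requires come from the
    values of the subexpressions. *)
Definition evals (rho : seq nat) (A : store) (e : expr) (v : nat) : Prop :=
  expr_ok n B rho A e /\ ev rho A e = v.

Implicit Types (rho : seq nat) (A : store).

Lemma evals_cst rho A c : c < B -> evals rho A (ECst c) c.
Proof. by []. Qed.

Lemma evals_add rho A e1 e2 v1 v2 : evals rho A e1 v1 -> evals rho A e2 v2 ->
  v1 + v2 < B -> evals rho A (EBin AAdd e1 e2) (v1 + v2).
Proof. by move=> [o1 <-] [o2 <-]. Qed.

Lemma evals_mul rho A e1 e2 v1 v2 : evals rho A e1 v1 -> evals rho A e2 v2 ->
  v1 * v2 < B -> evals rho A (EBin AMul e1 e2) (v1 * v2).
Proof. by move=> [o1 <-] [o2 <-]. Qed.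

Lemma evals_sub rho A e1 e2 v1 v2 : evals rho A e1 v1 -> evals rho A e2 v2 ->
  v2 <= v1 -> evals rho A (EBin ASub e1 e2) (v1 - v2).
Proof. by move=> [o1 <-] [o2 <-]. Qed.

Lemma evals_lt rho A e1 e2 v1 v2 : evals rho A e1 v1 -> evals rho A e2 v2 ->
  evals rho A (EBin ALt e1 e2) (v1 < v2).
Proof. by move=> [o1 <-] [o2 <-]. Qed.

Lemma evals_eq rho A e1 e2 (v1 v2 : nat) : evals rho A e1 v1 -> evals rho A e2 v2 ->
  evals rho A (EBin AEq e1 e2) (v1 == v2).
Proof. by move=> [o1 <-] [o2 <-]. Qed.

Lemma evals_and rho A e1 e2 (b1 b2 : bool) : evals rho A e1 b1 -> evals rho A e2 b2 ->
  evals rho A (EBin AMul e1 e2) (b1 && b2).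
Proof.
rewrite -mulnb => h1 h2; apply: evals_mul => //.
by apply: leq_ltn_trans B_gt1; case: b1 b2 {h1 h2} => [] [].
Qed.

(** Truth values are 0 and 1, so a sum expresses the disjunction of exclusive conditions. *)
Lemma evals_or rho A e1 e2 (b1 b2 : bool) : evals rho A e1 b1 -> evals rho A e2 b2 ->
  b1 && b2 = false -> evals rho A (EBin AAdd e1 e2) (b1 || b2).
Proof.
move=> h1 h2 h; have -> : (b1 || b2) = b1 + b2 :> nat by case: b1 b2 h {h1 h2} => [] [].
by apply: evals_add => //; apply: leq_ltn_trans B_gt1; case: b1 b2 h {h1 h2} => [] [].
Qed.

Lemma evals_cell rho A f e1 e2 i j : evals rho A e1 i -> evals rho A e2 j ->
  cell_valid n f i j -> evals rho A (ECell f e1 e2) (A f i j).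
Proof. by move=> [o1 <-] [o2 <-]. Qed.

Lemma evals_if rho A e1 e2 e3 v1 v2 v3 : evals rho A e1 v1 ->
  (v1 != 0 -> evals rho A e2 v2) -> (v1 = 0 -> evals rho A e3 v3) ->
  evals rho A (EIf e1 e2 e3) (if v1 != 0 then v2 else v3).
Proof.
move=> [o1 <-] h2 h3; split=> /=.
  by split=> // [/h2[]|/h3[]].
by case: eqP h2 h3 => /= [e _ /(_ e)[_ ->]|_ /(_ isT)[_ ->]].
Qed.

Lemma evals_if_bool rho A e1 e2 e3 (b : bool) v2 v3 : evals rho A e1 b ->
  (b -> evals rho A e2 v2) -> (~~ b -> evals rho A e3 v3) ->
  evals rho A (EIf e1 e2 e3) (if b then v2 else v3).
Proof.
move=> h1 h2 h3; have := @evals_if rho A e1 e2 e3 b v2 v3 h1.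
by case: b h2 h3 {h1} => h2 h3 /=; apply=> // _; (exact: h2 || exact: h3).
Qed.

Lemma evals_sum rho A e1 e2 m (F : nat -> nat) : evals rho A e1 m -> m <= n ->
  (forall i, i < m -> evals (rcons rho i) A e2 (F i)) -> \sum_(i < m) F i < B ->
  evals rho A (ESum e1 e2) (\sum_(i < m) F i).
Proof.
move=> [o1 <-] mn h2 hs.
have E : \sum_(i < ev rho A e1) ev (rcons rho i) A e2 = \sum_(i < ev rho A e1) F i.
  by apply: eq_bigr => i _; case: (h2 i (ltn_ord i)).
by split=> //=; split=> //; rewrite ?E // => i /h2[].
Qed.

Lemma evalsE rho A e v v' : evals rho A e v -> v = v' -> evals rho A e v'.
Proof. by move=> h <-. Qed.

Lemma fill1_evals rho f b e A N F : ~~ reads f.+1 e -> f < nfields ->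
  evals rho A b N -> N <= n -> (forall i, i < N -> evals (rcons rho i) A e (F i)) ->
  let s := fill1 (size rho) f.+1 b e in
  [/\ stmt_ok n B rho A s, same_but f.+1 A (sem rho s A)
    & forall i, i < N -> sem rho s A f.+1 i 0 = F i].
Proof.
move=> re fK [ob <-] Nn h s.
have [||ok sm] := @fill1_spec n B (ltnW B_gt1) rho f.+1 b e A re ob Nn.
- by move=> i /h[].
- by move=> i il /=; rewrite fK; lia.
split=> // [g i j /negPf gf|i il]; rewrite sm ?gf // eqxx il /=.
by case: (h i il).
Qed.

Lemma fill2_evals rho f b1 b2 e A N1 N2 F : ~~ reads f.+1 e -> ~~ reads f.+1 b2 ->
  f < nfields -> evals rho A b1 N1 -> N1 <= n ->
  (forall i, evals (rcons rho i) A b2 N2) -> N2 <= n ->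
  (forall i j, i < N1 -> j < N2 -> evals (rcons (rcons rho i) j) A e (F i j)) ->
  let s := fill2 (size rho) f.+1 b1 b2 e in
  [/\ stmt_ok n B rho A s, same_but f.+1 A (sem rho s A)
    & forall i j, i < N1 -> j < N2 -> sem rho s A f.+1 i j = F i j].
Proof.
move=> re rb fK [ob <-] Nn h2 N2n h s.
have [|||||ok sm] := @fill2_spec n B (ltnW B_gt1) rho f.+1 b1 b2 N2 e A re rb ob Nn.
- by move=> i; case: (h2 i).
- by move=> i; case: (h2 i).
- by [].
- by move=> i j il /(h i j il)[].
- by move=> i j il jl /=; rewrite fK; lia.
split=> // [g i j /negPf gf|i j il jl]; rewrite sm ?gf // eqxx il jl /=.
by case: (h i j il jl).
Qed.

(** Serves the output, where tags and values alternate: [g] maps the loop index to even or to odd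
    addresses, and its injectivity keeps later iterations from overwriting earlier ones. The last
    clause protects the other half. *)
Lemma scatter_evals rho f b r e A N g F :
  ~~ reads f r -> ~~ reads f e -> injective g ->
  evals rho A b N -> N <= n ->
  (forall i, i < N -> evals (rcons rho i) A r (g i)) ->
  (forall i, i < N -> evals (rcons rho i) A e (F i)) ->
  (forall i, i < N -> cell_valid n f (g i) 0) ->
  let s := SFor b (SStore f r (ECst 0) e) in
  [/\ stmt_ok n B rho A s, same_but f A (sem rho s A),
      forall i, i < N -> sem rho s A f (g i) 0 = F i
    & forall i j, (forall i', i' < N -> i <> g i') -> sem rho s A f i j = A f i j].
Proof.
move=> rr re gi [ob <-] Nn hr he hv s; rewrite /s [sem _ _ _]/=.
pose it m := iteri m (fun i => sem (rcons rho i) (SStore f r (ECst 0) e)) A.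
have itS m : it m.+1 = sem (rcons rho m) (SStore f r (ECst 0) e) (it m) by [].
have H m : m <= ev rho A b -> [/\ same_but f A (it m),
      forall i, i < m -> it m f (g i) 0 = F i
    & forall i j, (forall i', i' < m -> i <> g i') -> it m f i j = A f i j].
  elim: m => [|m IH] mN; first by split.
  have [sb h1 h2] := IH (ltnW mN); rewrite itS.
  have E f' i j : sem (rcons rho m) (SStore f r (ECst 0) e) (it m) f' i j =
       if [&& f' == f, i == g m & j == 0] then F m else it m f' i j.
    rewrite [sem _ _ _]/= !(ev_frame _ sb) // /set_cell.
    by case: (hr m mN) => _ ->; case: (he m mN) => _ ->.
  split.
  - by move=> f' i j ff; rewrite E (negPf ff) sb.
  - move=> i; rewrite ltnS leq_eqVlt => /orP[/eqP->|il]; first by rewrite E !eqxx.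
    rewrite E (inj_eq gi) eqxx /= h1 //.
    by case: eqP => // ?; lia.
  move=> i j hi; rewrite E eqxx /=; case: eqP => [e1|_] /=; last first.
    by rewrite h2 // => i' il; apply: hi; exact: ltnW.
  by case: (hi m).
have [sb h1 h2] := H _ (leqnn _).
split=> //; split=> // i il.
have [sbi _ _] := H i (ltnW il).
have [or er] := hr i il; have [oe ee] := he i il.
rewrite /=; split.
- exact: expr_ok_frame sbi rr or.
- exact: ltnW B_gt1.
- exact: expr_ok_frame sbi re oe.
- by rewrite (ev_frame _ sbi) // er; exact: hv.
Qed.

End Evals.

(** * The inversion program *)

Declare Scope expr_scope.
Delimit Scope expr_scope with X.
Notation "x + y" := (EBin AAdd x y) : expr_scope.
Notation "x - y" := (EBin ASub x y) : expr_scope.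
Notation "x * y" := (EBin AMul x y) : expr_scope.
Notation "x < y" := (EBin ALt x y) : expr_scope.
Notation "x == y" := (EBin AEq x y) : expr_scope.
Arguments EIf (_ _ _)%_X.
Arguments ESum (_ _)%_X.
Arguments ECell f%_N (_ _)%_X.
Arguments SStore f%_N (_ _ _)%_X.
Arguments SFor _%_X _.
Coercion ECst : nat >-> expr.

(** [fTag], [fSym] and [fCnt] hold the decoded pBWT; [fRow], [fZer] and [fLcp] are the state between
    rounds. The primed copies exist because a comprehension must not read the field it fills. [fOut]
    uses only row 0, and [fBeg] a single cell. *)
Notation fIn := 0.
Notation fTag := 1.
Notation fSym := 2.
Notation fCnt := 3.
Notation fRow := 4.
Notation fZer := 5.
Notation fLcp := 6.
Notation fPiv := 7.
Notation fNew := 8.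
Notation fOld := 9.
Notation fRow' := 10.
Notation fZer' := 11.
Notation fLcp' := 12.
Notation fOut := 13.
Notation fBeg := 14.

Section Code.
Local Open Scope expr_scope.

Definition xtag x := ECell fTag x 0.
Definition xsym x := ECell fSym x 0.
Definition xcnt x := ECell fCnt x 0.
Definition xpiv x := ECell fPiv x 0.
Definition xold x := ECell fOld x 0.
Definition xhead_lt x y :=
  (xtag x < xtag y) + (xtag x == xtag y) * (xsym x < xsym y).
Definition xhead_eq x y := (xtag x == xtag y) * (xsym x == xsym y).
Definition xflips x y :=
  (xpiv x < xpiv y) * (xpiv x < ECell fLcp x y + 1%N).
Definition xbefore x y :=
  xhead_lt x y +
  xhead_eq x y * EIf (x < y) (EIf (xflips x y) 0 1) ((y < x) * xflips y x).
Definition xmin x y := EIf (x < y) x y.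

Notation n := (EVar 0).

Definition setup : stmt :=
  let i := EVar 1 in
  SSeq (fill1 1 fTag n (ECell fIn (2%N * i) 0))
 (SSeq (fill1 1 fSym n (EIf (ECell fIn (2%N * i) 0) 0 (ECell fIn (2%N * i + 1%N) 0)))
       (fill1 1 fCnt n
          (EIf (ECell fIn (2%N * i) 0) (ECell fIn (2%N * i + 1%N) 0) (n + 1%N)))).

Definition xpivot : expr :=
  let i := EVar 2 in let q := EVar 3 in
  ESum (EVar 1) (ECell fZer i q < xcnt i).

Definition xnew : expr := ESum n (xbefore (EVar 3) (EVar 2)).

Definition xoldrow : expr :=
  ESum n (EVar 3 * (ECell fNew (EVar 3) 0 == EVar 2)).

Definition xrow : expr :=
  let i := xold (EVar 2) in let q := EVar 3 in
  EIf q (EIf (q - 1%N == xpiv i) q (ECell fRow i (q - 1%N)))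
        (EIf (xtag i) 0 (n + 1%N + i)).

(** The head contributes its tag, since a p-symbol starts as 0, and a pivot among the old columns
    before [q] loses its zero. Counting afresh with a sum for each entry would make a round
    cubic. *)
Definition xzeros : expr :=
  let i := xold (EVar 2) in let q := EVar 3 in
  EIf q (xtag i + ECell fZer i (q - 1%N) - (xpiv i < q)) (xtag i).

Definition xlcp : expr :=
  let i := xold (EVar 2) in let j := xold (EVar 3) in
  xhead_eq i j *
    (EIf (xpiv i == xpiv j) (ECell fLcp i j)
       (xmin (ECell fLcp i j) (xmin (xpiv i) (xpiv j))) + 1%N).

Definition round : stmt :=
  let k1 := EVar 1 + 1%N in let i := EVar 2 in let j := EVar 3 in
  SSeq (fill1 2 fPiv n xpivot)
 (SSeq (fill1 2 fNew n xnew)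
 (SSeq (fill1 2 fOld n xoldrow)
 (SSeq (fill2 2 fRow' n k1 xrow)
 (SSeq (fill2 2 fZer' n k1 xzeros)
 (SSeq (fill2 2 fLcp' n n xlcp)
 (SSeq (fill2 2 fRow n k1 (ECell fRow' i j))
 (SSeq (fill2 2 fZer n k1 (ECell fZer' i j))
       (fill2 2 fLcp n n (ECell fLcp' i j))))))))).

Definition xbeg := ECell fBeg 0 0.

(** A nonzero entry up to n is a distance, and the name is copied from that far back; an entry above
    n points to a static symbol and gets a dummy 0; an entry 0 is a new p-symbol, numbered by the
    zeros before it. *)
Definition xout : expr :=
  let q := EVar 1 in let x := ECell fRow xbeg q in
  EIf x (EIf (n < x) 0 (ECell fOut 0 (q - x))) (ECell fZer xbeg q - 1%N).

Definition xstart : expr :=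
  ESum n (EVar 1 * ((xtag (EVar 1) == 0%N) * (xsym (EVar 1) == 0%N))).

Definition xtagout : expr := ECell fRow xbeg (EVar 1) < n + 1%N.

Definition xvalout : expr :=
  let q := EVar 1 in let x := ECell fRow xbeg q in
  EIf (n < x) (xsym (x - (n + 1%N))) (ECell fOut 0 q).

(** The names form a recurrence, so their loop reads entries of the field it is writing and is no
    comprehension. The input area can be overwritten because [setup] has copied its contents. *)
Definition output : stmt :=
  SSeq (SStore fBeg 0 0 xstart)
 (SSeq (SFor n (SStore fOut 0 (EVar 1) xout))
 (SSeq (SFor n (SStore fIn (2%N * EVar 1) 0 xtagout))
       (SFor n (SStore fIn (2%N * EVar 1 + 1%N) 0 xvalout)))).

Definition inversion : stmt := SSeq setup (SSeq (SFor n round) output).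

Lemma inversion_deg : stmt_deg inversion = 3.
Proof. by []. Qed.

End Code.

Lemma sum_bumped (ds : Order.disp_t) (Ss : finOrderType ds) n
    (E : nat -> nat -> ecode Ss) (piv : nat -> nat) i q :
  (piv i < n -> E i (piv i) = inr 0) -> q <= n ->
  \sum_(j < q) (bumped E piv i j == inr 0) + (piv i < q) =
  \sum_(j < q) (E i j == inr 0).
Proof.
move=> hp; elim: q => [|q IH] qn; first by rewrite !big_ord0 ltn0.
rewrite !big_ord_recr /= -IH ?(ltnW qn) // /bumped.
case: (q =P piv i) => [e|ne]; first by rewrite e ltnn ltnSn hp -?e // eqxx.
have -> : (piv i < q.+1) = (piv i < q) by lia.
by rewrite addnAC.
Qed.

Lemma lcp_prepended (ds : Order.disp_t) (Ss : finOrderType ds)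
    (E : nat -> nat -> ecode Ss) (hd : nat -> ecode Ss) (piv : nat -> nat) i j k :
  lcp (prepended E hd piv i) (prepended E hd piv j) k.+1 =
  if hd i == hd j then (lcp (bumped E piv i) (bumped E piv j) k).+1 else 0.
Proof.
case: eqP => [e|ne]; last by apply: lcp_unique.
apply: lcp_unique; first exact: lcp_le.
  by case=> [_|q] //=; rewrite ltnS => /lcp_eq.
by rewrite ltnS => /lcp_neq.
Qed.

Lemma seq_correct n B rho s1 s2 A (Q : store -> Prop) :
  stmt_ok n B rho A s1 ->
  stmt_ok n B rho (sem rho s1 A) s2 /\ Q (sem rho s2 (sem rho s1 A)) ->
  stmt_ok n B rho A (SSeq s1 s2) /\ Q (sem rho (SSeq s1 s2) A).
Proof. by move=> ok1 [ok2 q]. Qed.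

(** * Correctness of the array program *)

Section Correctness.
Variables (ds dp : Order.disp_t) (Ss : finOrderType ds) (Sp : finOrderType dp).
Variables (dollar : Ss) (n : nat) (T : seq (psym Ss Sp)) (B : nat).
Hypotheses (n_gt0 : 0 < n) (size_T : size T = n).
Hypothesis T_dollar : forall q, q < n ->
  (nth (inl dollar) T q == inl dollar) = (q.+1 == n).
(** Leaves ample room for the computed values: codes up to 2n, zero counts, prefix lengths, indices
    and small constants. Ranks of static symbols are only compared and copied. *)
Hypothesis B_ge : 4 * n + 20 <= B.

Notation enc := (enc T).
Notation fcode := (fcode dollar T).
Notation pivot := (pivot dollar n T).
Notation lastc := (lastc dollar T).
Notation zeros_upto := (zeros_upto T).
Notation evals := (evals n B).

Let B_gt1 : 1 < B. Proof. by apply: leq_trans B_ge; rewrite addnC. Qed.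

Definition ptag i : bool := if fcode i is inr _ then true else false.
Definition ssym i : nat := if fcode i is inl s then Order.enum_rank s else 0.
Definition pcnt i : nat :=
  if lastc i is inl _ then n.+1 else zeros_upto i (pivot i).

Lemma enum_rank_lt (s s' : Ss) :
  ((Order.enum_rank s : nat) < Order.enum_rank s') = (s < s')%O.
Proof.
have := Order.le_enum_rank (@le_total _ Ss) s' s; rewrite leEord => h.
by rewrite ltNge -h -ltnNge.
Qed.

Lemma fcode_zero i v : fcode i = inr v -> v = 0.
Proof. by rewrite /fcode; case: (lastc i) => [s|p] // [<-]. Qed.

(** The only integer among the heads is 0, so the pair of tag and rank decides; static symbols have
    tag 0 and come first. *)
Lemma fcode_ltE i j :
  ecode_lt (fcode i) (fcode j) = (ptag i < ptag j) || (ptag i == ptag j) && (ssym i < ssym j).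
Proof.
rewrite /ptag /ssym; case Ei: (fcode i) => [s|v]; case Ej: (fcode j) => [s'|v'] //=.
  by rewrite enum_rank_lt.
by rewrite (fcode_zero Ei) (fcode_zero Ej).
Qed.

Lemma fcode_eqE i j : (fcode i == fcode j) = (ptag i == ptag j) && (ssym i == ssym j).
Proof.
rewrite /ptag /ssym; case Ei: (fcode i) => [s|v]; case Ej: (fcode j) => [s'|v'] //=.
  rewrite (inj_eq (@inl_inj _ _)) -(inj_eq (@Order.enum_rank_inj _ _)).
  by [].
by rewrite (fcode_zero Ei) (fcode_zero Ej) !eqxx.
Qed.

Lemma tagE i : ptag i = (fcode i == inr 0).
Proof. by rewrite /ptag; case E: (fcode i) => [s|v] //; rewrite (fcode_zero E) eqxx. Qed.

(* A row stores a static symbol as a pointer, shifted by n + 1, to an entry of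
   the pBWT that holds it: its rank may be too large to be shifted itself. *)
Definition codes (x : nat) (e : ecode Ss) : Prop :=
  match e with
  | inr v => x = v
  | inl s => exists2 i, i < n & x = n.+1 + i /\ fcode i = inl s
  end.

Definition input_read (A : store) : Prop :=
  forall i, i < n -> [/\ A fTag i 0 = ptag i, A fSym i 0 = ssym i & A fCnt i 0 = pcnt i].

(** The invariant between rounds. The fields from 7 on are refilled before they are read, so it says
    nothing about them. *)
Record read_upto (k : nat) (A : store) : Prop := ReadUpto {
  read_input : input_read A;
  read_row : forall i q, i < n -> q < k -> codes (A fRow i q) (enc i q);
  read_zeros : forall i q, i < n -> q < k -> A fZer i q = zeros_upto i q;
  read_lcp : forall i j, i < n -> j < n -> A fLcp i j = lcp (enc i) (enc j) k }.

Lemma read_upto_same f k A A' :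
  6 < f -> same_but f A A' -> read_upto k A -> read_upto k A'.
Proof.
move=> hf sb [h1 h2 h3 h4]; split.
- by move=> i /h1[<- <- <-]; rewrite !sb //; lia.
- by move=> i q il ql; rewrite sb; [exact: h2|lia].
- by move=> i q il ql; rewrite sb ?h3 //; lia.
- by move=> i q il ql; rewrite sb ?h4 //; lia.
Qed.

Lemma evals_tag rho A x i : input_read A -> evals rho A x i -> i < n ->
  evals rho A (xtag x) (ptag i).
Proof.
move=> h hx il; have [<- _ _] := h i il.
apply: evals_cell => //; first by apply: evals_cst; lia.
by rewrite /= il.
Qed.

Lemma evals_sym rho A x i : input_read A -> evals rho A x i -> i < n ->
  evals rho A (xsym x) (ssym i).
Proof.
move=> h hx il; have [_ <- _] := h i il.
apply: evals_cell => //; first by apply: evals_cst; lia.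
by rewrite /= il.
Qed.

Lemma evals_cnt rho A x i : input_read A -> evals rho A x i -> i < n ->
  evals rho A (xcnt x) (pcnt i).
Proof.
move=> h hx il; have [_ _ <-] := h i il.
apply: evals_cell => //; first by apply: evals_cst; lia.
by rewrite /= il.
Qed.

Lemma evals_head_eq rho A x y i j : input_read A ->
  evals rho A x i -> evals rho A y j -> i < n -> j < n ->
  evals rho A (xhead_eq x y) (fcode i == fcode j).
Proof.
move=> h hx hy il jl; rewrite fcode_eqE; apply: evals_and => //.
  have -> : (ptag i == ptag j) = ((ptag i : nat) == ptag j) by case: (ptag i) (ptag j) => [] [].
  by apply: evals_eq; apply: evals_tag.
by apply: evals_eq; apply: evals_sym.
Qed.

Lemma evals_head_lt rho A x y i j : input_read A ->
  evals rho A x i -> evals rho A y j -> i < n -> j < n ->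
  evals rho A (xhead_lt x y) (ecode_lt (fcode i) (fcode j)).
Proof.
move=> h hx hy il jl; rewrite fcode_ltE; apply: evals_or => //.
- by apply: evals_lt; apply: evals_tag.
- apply: evals_and => //; last by apply: evals_lt; apply: evals_sym.
  have -> : (ptag i == ptag j) = ((ptag i : nat) == ptag j) by case: (ptag i) (ptag j) => [] [].
  by apply: evals_eq; apply: evals_tag.
by case: (ptag i) (ptag j) => [] [].
Qed.

Section Round.
Variable k : nat.
Hypothesis k_lt : k < n.
Notation kp := (kpiv pivot k).
Notation old := (old_row n enc fcode pivot k).
Notation new := (new_row n enc fcode pivot k).

Lemma kp_le i : kp i <= k. Proof. exact: geq_minl. Qed.

Lemma evals_piv rho A x i : (forall i, i < n -> A fPiv i 0 = kp i) ->
  evals rho A x i -> i < n -> evals rho A (xpiv x) (kp i).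
Proof.
move=> h hx il; rewrite -h //.
apply: evals_cell => //; first by apply: evals_cst; lia.
by rewrite /= il.
Qed.

Lemma evals_lcp rho A x y i j : read_upto k A ->
  evals rho A x i -> evals rho A y j -> i < n -> j < n ->
  evals rho A (ECell fLcp x y) (lcp (enc i) (enc j) k).
Proof.
move=> h hx hy il jl; rewrite -(read_lcp h) //.
by apply: evals_cell => //; rewrite /= il.
Qed.

Lemma evals_flips rho A x y i j : read_upto k A ->
  (forall i, i < n -> A fPiv i 0 = kp i) ->
  evals rho A x i -> evals rho A y j -> i < n -> j < n ->
  evals rho A (xflips x y) (flips enc pivot k i j).
Proof.
move=> h hp hx hy il jl; have lk := lcp_le (enc i) (enc j) k.
rewrite /flips; apply: evals_and => //; first by apply: evals_lt; apply: evals_piv.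
have -> : (kp i <= lcp (enc i) (enc j) k) = (kp i < lcp (enc i) (enc j) k + 1) by lia.
apply: evals_lt; first exact: evals_piv.
by apply: evals_add; [exact: evals_lcp|apply: evals_cst|]; lia.
Qed.

Lemma evals_before rho A x y i j : read_upto k A ->
  (forall i, i < n -> A fPiv i 0 = kp i) ->
  evals rho A x i -> evals rho A y j -> i < n -> j < n ->
  evals rho A (xbefore x y) (before enc fcode pivot k i j).
Proof.
move=> h hp hx hy il jl; have hi := read_input h; rewrite /before.
apply: evals_or => //; first exact: evals_head_lt.
- apply: evals_and => //; first exact: evals_head_eq.
  apply: (@evalsE _ _ _ _ _ (if i < j then (if flips enc pivot k i j then 0 else 1)
            else (j < i) && flips enc pivot k j i : nat)); last first.
    by case: (i < j) => //; case: flips.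
  apply: evals_if_bool; first exact: evals_lt.
    move=> _; apply: evals_if_bool; first exact: evals_flips.
      by move=> _; apply: evals_cst; lia.
    by move=> _; apply: evals_cst; lia.
  move=> _; apply: evals_and => //; first exact: evals_lt.
  exact: evals_flips.
case: (boolP (ecode_lt _ _)) => //= hl; case: eqP => //= e.
by rewrite e ecode_ltxx in hl.
Qed.


Let E_le := enc_le dollar size_T.
Let E_piv := enc_pivot (dollar := dollar) n_gt0 size_T.
Let E_sorted := enc_sorted size_T.
Let E_perm := enc_perm dollar n_gt0 size_T.

Lemma old_row_lt a : a < n -> old a < n.
Proof. by move=> al; case: (old_row_spec fcode E_le E_piv E_sorted k_lt al). Qed.

Lemma enc_old a q : a < n -> q <= k ->
  enc a q = prepended enc fcode pivot (old a) q.
Proof. by move=> al qk; rewrite (prepended_old_row E_le E_piv E_sorted E_perm k_lt). Qed.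

Lemma new_row_le i : new i <= n.
Proof.
rewrite /new_row -[leqRHS]card_ord -sum1_card.
by apply: leq_sum => j _; case: before.
Qed.

Lemma zeros_old a q : a < n -> q <= k ->
  zeros_upto a q = if q == 0 then ptag (old a) : nat
    else ptag (old a) + zeros_upto (old a) q.-1 - (kp (old a) < q).
Proof.
move=> al qk; have ol := old_row_lt al.
rewrite /zeros_upto big_ord_recl enc_old //= -tagE.
have -> : \sum_(j < q) (enc a (bump 0 j) == inr 0) =
          \sum_(j < q) (bumped enc pivot (old a) j == inr 0).
  by apply: eq_bigr => j _; rewrite enc_old //=; have := ltn_ord j; rewrite /bump; lia.
case: q qk => [|q] qk /=; first by rewrite big_ord0 addn0.
rewrite -(sum_bumped (n := n) (E_piv ol)); last lia.
have -> : (kp (old a) < q.+1) = (pivot (old a) < q.+1) by rewrite /kpiv; lia.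
by rewrite addnA addnK.
Qed.

Lemma lcp_old a b : a < n -> b < n ->
  lcp (enc a) (enc b) k.+1 =
  (fcode (old a) == fcode (old b)) *
  ((if kp (old a) == kp (old b) then lcp (enc (old a)) (enc (old b)) k
    else minn (lcp (enc (old a)) (enc (old b)) k) (minn (kp (old a)) (kp (old b)))) + 1).
Proof.
move=> al bl; have oa := old_row_lt al; have ob := old_row_lt bl.
rewrite (@eq_lcp _ _ _ (prepended enc fcode pivot (old a)) (prepended enc fcode pivot (old b))).
- rewrite lcp_prepended (lcp_bumped E_le E_piv k_lt oa ob).
  by case: (_ == _ :> ecode Ss); rewrite ?mul1n ?addn1.
- by move=> q qk; apply: enc_old.
- by move=> q qk; apply: enc_old.
Qed.

Lemma evals_old rho A x i : (forall i, i < n -> A fOld i 0 = old i) ->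
  evals rho A x i -> i < n -> evals rho A (xold x) (old i).
Proof.
move=> h hx il; rewrite -h //.
apply: evals_cell => //; first by apply: evals_cst; lia.
by rewrite /= il.
Qed.

Lemma evals_xmin rho A x y u v : evals rho A x u -> evals rho A y v ->
  evals rho A (xmin x y) (minn u v).
Proof. by move=> hx hy; apply: evals_if_bool => //; exact: evals_lt. Qed.

Lemma evals_xpivot A i : read_upto k A -> i < n ->
  evals [:: n; k; i] A xpivot (kp i).
Proof.
move=> h il; have hi := read_input h.
have <- := kpiv_sum n_gt0 size_T il (ltnW k_lt) (erefl (pcnt i)).
have S := kpiv_sum n_gt0 size_T il (ltnW k_lt) (erefl (pcnt i)).
apply: (@evals_sum _ _ _ _ _ _ k (fun q => zeros_upto i q < pcnt i)) => //.
- exact: ltnW.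
- move=> q qk /=; apply: evals_lt.
    rewrite -(read_zeros h) //; apply: evals_cell.
    + by [].
    + by [].
    + by rewrite /= il (ltn_trans qk).
  exact: evals_cnt.
- by rewrite S; have := kp_le i; lia.
Qed.

Lemma evals_xnew A i : read_upto k A -> (forall i, i < n -> A fPiv i 0 = kp i) ->
  i < n -> evals [:: n; k; i] A xnew (new i).
Proof.
move=> h hp il.
apply: (@evals_sum _ _ _ _ _ _ n (fun j => before enc fcode pivot k j i)) => //.
- by move=> j jl /=; apply: evals_before.
- by have := new_row_le i; rewrite /new_row; lia.
Qed.

Lemma evals_xoldrow A a : (forall i, i < n -> A fNew i 0 = new i) -> a < n ->
  evals [:: n; k; a] A xoldrow (old a).
Proof.
move=> h al.
apply: (@evals_sum _ _ _ _ _ _ n (fun i => i * (new i == a))) => //; last first.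
  by rewrite -/(old_row n enc fcode pivot k a); have := old_row_lt al; lia.
move=> i il /=; apply: evals_mul => //; last first.
  by apply: (@leq_ltn_trans i); [case: (_ == _)|]; lia.
apply: evals_eq => //; rewrite -h //; apply: evals_cell => //.
  by apply: evals_cst; lia.
by rewrite /= il.
Qed.

Section Gather.
Variable A : store.
Hypotheses (A_read : read_upto k A) (A_piv : forall i, i < n -> A fPiv i 0 = kp i).
Hypothesis A_old : forall i, i < n -> A fOld i 0 = old i.
Variables (a q : nat).
Hypothesis a_lt : a < n.

Let oa := old_row_lt a_lt.
Let o_ev : evals [:: n; k; a; q] A (xold (EVar 2)) (old a).
Proof. exact: evals_old. Qed.
Let q_ev : evals [:: n; k; a; q] A (EVar 3) q. Proof. by []. Qed.
Let q1_ev : q != 0 -> evals [:: n; k; a; q] A (EBin ASub (EVar 3) 1) (q - 1).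
Proof. by move=> q0; apply: evals_sub; [by []|apply: evals_cst|]; lia. Qed.

Lemma evals_xrow : q <= k ->
  evals [:: n; k; a; q] A xrow
    (if q != 0 then (if q - 1 == kp (old a) then q else A fRow (old a) (q - 1))
     else (if ptag (old a) then 0 else n + 1 + old a)).
Proof.
move=> qk; have hi := read_input A_read; apply: evals_if => //.
  move=> q0; apply: evals_if_bool => //.
    by apply: evals_eq; [exact: q1_ev|exact: evals_piv].
  move=> _; apply: evals_cell => //; first exact: q1_ev.
  by rewrite /= oa; lia.
move=> _; apply: evals_if_bool; first exact: evals_tag.
  by move=> _; apply: evals_cst; lia.
move=> _; apply: evals_add => //; last lia.
by apply: evals_add; [by []|apply: evals_cst|]; lia.
Qed.

Lemma codes_xrow : q <= k ->
  codes (if q != 0 then (if q - 1 == kp (old a) then q else A fRow (old a) (q - 1))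
     else (if ptag (old a) then 0 else n + 1 + old a)) (enc a q).
Proof.
move=> qk; rewrite enc_old //; case: q qk => [|q'] qk /=.
  rewrite /ptag; case E: (fcode (old a)) => [s|v] /=; last by rewrite (fcode_zero E).
  by exists (old a) => //; rewrite addn1.
rewrite subn1 /= /bumped.
(* Among the columns below [k] the capped pivot and the pivot pick out the same one. *)
have -> : (q' == kp (old a)) = (q' == pivot (old a)) by rewrite /kpiv; lia.
by case: ifP => // _; apply: (read_row A_read).
Qed.

Lemma evals_xzeros : q <= k ->
  evals [:: n; k; a; q] A xzeros (zeros_upto a q).
Proof.
move=> qk; have hi := read_input A_read; rewrite zeros_old //.
have t_ev : evals [:: n; k; a; q] A (xtag (xold (EVar 2))) (ptag (old a)) by exact: evals_tag.
apply: (@evalsE _ _ _ _ _ (if q != 0 then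
   ptag (old a) + zeros_upto (old a) (q - 1) - (kp (old a) < q) else ptag (old a) : nat)); last first.
  by rewrite subn1; case: eqP.
apply: evals_if => // q0.
have zle := zeros_upto_le T (old a) (q - 1).
apply: evals_sub.
- apply: evals_add => //; last by case: (ptag (old a)); lia.
  rewrite -(read_zeros A_read) //; last lia.
  by apply: evals_cell => //; [exact: q1_ev|rewrite /= oa; lia].
- by apply: evals_lt => //; exact: evals_piv.
(* When 1 is subtracted, the pivot is one of the counted columns and holds a zero, so the count is
   positive. *)
case: (ltnP (kp (old a)) q) => // kq; rewrite addn_gt0.
have pq : pivot (old a) < q by move: kq; rewrite /kpiv; lia.
suff -> : 0 < zeros_upto (old a) (q - 1) by rewrite orbT.
have pl : pivot (old a) < (q - 1).+1 by lia.
rewrite /zeros_upto (bigD1 (Ordinal pl)) //= E_piv ?eqxx //; lia.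
Qed.

Lemma evals_xlcp : q < n ->
  evals [:: n; k; a; q] A xlcp (lcp (enc a) (enc q) k.+1).
Proof.
move=> ql; have hi := read_input A_read; rewrite lcp_old //.
have ob := old_row_lt ql.
have lk := lcp_le (enc (old a)) (enc (old q)) k.
have o'_ev : evals [:: n; k; a; q] A (xold (EVar 3)) (old q) by exact: evals_old.
set v := (if _ then _ else _).
have vk : v <= k by rewrite /v; case: ifP => _ //; lia.
apply: evals_mul; first exact: evals_head_eq.
  apply: evals_add; [|by apply: evals_cst; lia|lia].
  apply: evals_if_bool.
  - by apply: evals_eq; exact: evals_piv.
  - by move=> _; exact: evals_lcp.
  - by move=> _; do 2?[apply: evals_xmin]; [exact: evals_lcp|exact: evals_piv|exact: evals_piv].
by case: (_ == _ :> ecode Ss); lia.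
Qed.

End Gather.

Lemma round_correct A : read_upto k A ->
  stmt_ok n B [:: n; k] A round /\ read_upto k.+1 (sem [:: n; k] round A).
Proof.
move=> h0.
have nev rho A' : evals (n :: rho) A' (EVar 0) n by [].
have k1ev i A' : evals [:: n; k; i] A' (EBin AAdd (EVar 1) 1) k.+1.
  by rewrite -[k.+1]addn1; apply: evals_add; [by []|apply: evals_cst|]; lia.
have k1n : k.+1 <= n by [].
have copy A' f i j : f < nfields -> i < n -> j < n ->
    evals [:: n; k; i; j] A' (ECell f.+1 (EVar 2) (EVar 3)) (A' f.+1 i j).
  by move=> fK il jl; apply: evals_cell => //=; rewrite fK il.
have [ok1 sb1 v1] := @fill1_evals n B B_gt1 [:: n; k] 6 (EVar 0) xpivot A n kp
  isT isT (nev _ _) (leqnn n) (fun i il => evals_xpivot h0 il).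
change (size [:: n; k]) with 2 in ok1, sb1, v1.
have h1 := read_upto_same (f := 7) isT sb1 h0.
apply: seq_correct ok1 _; move: (sem _ _ A) sb1 v1 h1 => A1 sb1 v1 h1.
have [ok2 sb2 v2] := @fill1_evals n B B_gt1 [:: n; k] 7 (EVar 0) xnew A1 n new
  isT isT (nev _ _) (leqnn n) (fun i il => evals_xnew h1 v1 il).
change (size [:: n; k]) with 2 in ok2, sb2, v2.
have h2 := read_upto_same (f := 8) isT sb2 h1.
apply: seq_correct ok2 _; move: (sem _ _ A1) sb2 v2 h2 => A2 sb2 v2 h2.
have p2 i : i < n -> A2 fPiv i 0 = kp i by move=> il; rewrite sb2 // v1.
have [ok3 sb3 v3] := @fill1_evals n B B_gt1 [:: n; k] 8 (EVar 0) xoldrow A2 n old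
  isT isT (nev _ _) (leqnn n) (fun i il => evals_xoldrow v2 il).
change (size [:: n; k]) with 2 in ok3, sb3, v3.
have h3 := read_upto_same (f := 9) isT sb3 h2.
apply: seq_correct ok3 _; move: (sem _ _ A2) sb3 v3 h3 => A3 sb3 v3 h3.
have p3 i : i < n -> A3 fPiv i 0 = kp i by move=> il; rewrite sb3 // p2.
have [ok4 sb4 v4] := @fill2_evals n B B_gt1 [:: n; k] 9 (EVar 0) (EVar 1 + 1%N)%X xrow A3 n k.+1 _
  isT isT isT (nev _ _) (leqnn n) (fun i => k1ev i A3) k1n
  (fun a q al qk => evals_xrow h3 p3 v3 al qk).
change (size [:: n; k]) with 2 in ok4, sb4, v4.
have h4 := read_upto_same (f := 10) isT sb4 h3.
(* Recorded in terms of the encoding at once, since the formula for the entries refers to the store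
   before the fill. *)
have {}v4 a q : a < n -> q < k.+1 ->
    codes (sem [:: n; k] (fill2 2 10 (EVar 0) (EBin AAdd (EVar 1) 1) xrow) A3 fRow' a q) (enc a q).
  by move=> al qk; rewrite v4 //; apply: codes_xrow.
apply: seq_correct ok4 _; move: (sem _ _ A3) sb4 v4 h4 => A4 sb4 v4 h4.
have p4 i : i < n -> A4 fPiv i 0 = kp i by move=> il; rewrite sb4 // p3.
have o4 i : i < n -> A4 fOld i 0 = old i by move=> il; rewrite sb4 // v3.
have [ok5 sb5 v5] := @fill2_evals n B B_gt1 [:: n; k] 10 (EVar 0) (EVar 1 + 1%N)%X xzeros A4 n k.+1 _
  isT isT isT (nev _ _) (leqnn n) (fun i => k1ev i A4) k1n
  (fun a q al qk => evals_xzeros h4 p4 o4 al qk).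
change (size [:: n; k]) with 2 in ok5, sb5, v5.
have h5 := read_upto_same (f := 11) isT sb5 h4.
apply: seq_correct ok5 _; move: (sem _ _ A4) sb5 v5 h5 => A5 sb5 v5 h5.
have p5 i : i < n -> A5 fPiv i 0 = kp i by move=> il; rewrite sb5 // p4.
have o5 i : i < n -> A5 fOld i 0 = old i by move=> il; rewrite sb5 // o4.
have [ok6 sb6 v6] := @fill2_evals n B B_gt1 [:: n; k] 11 (EVar 0) (EVar 0) xlcp A5 n n _
  isT isT isT (nev _ _) (leqnn n) (fun i => nev [:: k; i] A5) (leqnn n)
  (fun a b al bl => evals_xlcp h5 p5 o5 al bl).
change (size [:: n; k]) with 2 in ok6, sb6, v6.
have h6 := read_upto_same (f := 12) isT sb6 h5.
apply: seq_correct ok6 _; move: (sem _ _ A5) sb6 v6 h6 => A6 sb6 v6 h6.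
have [ok7 sb7 v7] := @fill2_evals n B B_gt1 [:: n; k] 3 (EVar 0) (EVar 1 + 1%N)%X
  (ECell fRow' (EVar 2) (EVar 3)) A6 n k.+1 (A6 fRow')
  isT isT isT (nev _ _) (leqnn n) (fun i => k1ev i A6) k1n
  (fun a q al qk => copy A6 9 a q isT al (leq_trans qk k1n)).
change (size [:: n; k]) with 2 in ok7, sb7, v7.
apply: seq_correct ok7 _; move: (sem _ _ A6) sb7 v7 => A7 sb7 v7.
have [ok8 sb8 v8] := @fill2_evals n B B_gt1 [:: n; k] 4 (EVar 0) (EVar 1 + 1%N)%X
  (ECell fZer' (EVar 2) (EVar 3)) A7 n k.+1 (A7 fZer')
  isT isT isT (nev _ _) (leqnn n) (fun i => k1ev i A7) k1n
  (fun a q al qk => copy A7 10 a q isT al (leq_trans qk k1n)).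
change (size [:: n; k]) with 2 in ok8, sb8, v8.
apply: seq_correct ok8 _; move: (sem _ _ A7) sb8 v8 => A8 sb8 v8.
have [ok9 sb9 v9] := @fill2_evals n B B_gt1 [:: n; k] 5 (EVar 0) (EVar 0)
  (ECell fLcp' (EVar 2) (EVar 3)) A8 n n (A8 fLcp')
  isT isT isT (nev _ _) (leqnn n) (fun i => nev [:: k; i] A8) (leqnn n)
  (fun a b al bl => copy A8 11 a b isT al bl).
change (size [:: n; k]) with 2 in ok9, sb9, v9.
split=> //; split.
- move=> i il; have [<- <- <-] := read_input h6 il.
  by rewrite !sb9 // !sb8 // !sb7.
- by move=> i q il qk; rewrite sb9 // sb8 // v7 // sb6 // sb5 //; apply: v4.
- by move=> i q il qk; rewrite sb9 // v8 // sb7 // sb6 // v5.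
- by move=> i j il jl; rewrite v9 // sb8 // sb7 // v6.
Qed.

End Round.

Lemma codes_le x i q : i < n -> q < n -> codes x (enc i q) -> x <= 2 * n.
Proof.
move=> il ql; case E: (enc i q) => [s|v] /=.
  by case=> i' il' [-> _]; lia.
by move=> ->; have := enc_le dollar size_T il ql E; lia.
Qed.

(** The zeros in [fLcp], supplied by fresh memory, are the common prefix lengths of rows of which
    nothing has been read. *)
Definition holds_input (A : store) : Prop :=
  (forall i, i < n -> A fIn (2 * i) 0 = ptag i /\
     A fIn (2 * i + 1) 0 = if ptag i then pcnt i else ssym i) /\
  forall i j, i < n -> j < n -> A fLcp i j = 0.

Lemma sym_tag i : ptag i -> ssym i = 0.
Proof. by rewrite /ptag /ssym; case: (fcode i). Qed.

Lemma cnt_tag i : ptag i = false -> pcnt i = n + 1.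
Proof. by rewrite /ptag /pcnt /fcode addn1; case: (lastc i). Qed.

Lemma setup_correct A : holds_input A ->
  stmt_ok n B [:: n] A setup /\ read_upto 0 (sem [:: n] setup A).
Proof.
move=> [h0 hl].
have nev rho A' : evals (n :: rho) A' (EVar 0) n by [].
have i2ev i A' : i < n -> evals [:: n; i] A' (2%N * EVar 1)%X (2 * i).
  by move=> il; apply: evals_mul; [apply: evals_cst|by []|]; lia.
have tev i (A' : store) : i < n -> A' fIn (2 * i) 0 = ptag i ->
    evals [:: n; i] A' (ECell fIn (2%N * EVar 1)%X 0) (ptag i).
  move=> il <-; apply: evals_cell; [exact: i2ev|by apply: evals_cst; lia|].
  by rewrite /= ltn_mul2l il.
have vev i (A' : store) : i < n -> evals [:: n; i] A' (ECell fIn (2%N * EVar 1 + 1%N)%X 0) (A' fIn (2 * i + 1) 0).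
  move=> il; apply: evals_cell; [|by apply: evals_cst; lia|rewrite /=; lia].
  by apply: evals_add; [exact: i2ev|apply: evals_cst|]; lia.
have [ok1 sb1 v1] := @fill1_evals n B B_gt1 [:: n] 0 (EVar 0)
  (ECell fIn (2%N * EVar 1)%X 0) A n ptag isT isT (nev _ _) (leqnn n)
  (fun i il => tev i A il (h0 i il).1).
change (size [:: n]) with 1 in ok1, sb1, v1.
apply: seq_correct ok1 _; move: (sem _ _ A) sb1 v1 => A1 sb1 v1.
have e2 i : i < n -> evals [:: n; i] A1
    (EIf (ECell fIn (2%N * EVar 1)%X 0) 0 (ECell fIn (2%N * EVar 1 + 1%N)%X 0)) (ssym i).
  move=> il; have [t0 s0] := h0 i il.
  apply: (@evalsE _ _ _ _ _ (if ptag i then 0 else A1 fIn (2 * i + 1) 0)); last first.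
    by rewrite sb1 // s0; case E: (ptag i) => //; rewrite sym_tag.
  by apply: evals_if_bool => [|_|_]; [apply: tev => //; rewrite sb1|apply: evals_cst; lia|exact: vev].
have [ok2 sb2 v2] := @fill1_evals n B B_gt1 [:: n] 1 (EVar 0)
  (EIf (ECell fIn (2%N * EVar 1)%X 0) 0 (ECell fIn (2%N * EVar 1 + 1%N)%X 0)) A1 n ssym
  isT isT (nev _ _) (leqnn n) e2.
change (size [:: n]) with 1 in ok2, sb2, v2.
apply: seq_correct ok2 _; move: (sem _ _ A1) sb2 v2 => A2 sb2 v2.
have e3 i : i < n -> evals [:: n; i] A2
    (EIf (ECell fIn (2%N * EVar 1)%X 0) (ECell fIn (2%N * EVar 1 + 1%N)%X 0) (EVar 0 + 1%N)%X) (pcnt i).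
  move=> il; have [t0 s0] := h0 i il.
  apply: (@evalsE _ _ _ _ _ (if ptag i then A2 fIn (2 * i + 1) 0 else n + 1)); last first.
    by rewrite sb2 // sb1 // s0; case E: (ptag i) => //; rewrite cnt_tag.
  apply: evals_if_bool => [|_|_]; [by apply: tev => //; rewrite sb2 // sb1|exact: vev|].
  by apply: evals_add; [by []|apply: evals_cst|]; lia.
have [ok3 sb3 v3] := @fill1_evals n B B_gt1 [:: n] 2 (EVar 0)
  (EIf (ECell fIn (2%N * EVar 1)%X 0) (ECell fIn (2%N * EVar 1 + 1%N)%X 0) (EVar 0 + 1%N)%X) A2 n pcnt
  isT isT (nev _ _) (leqnn n) e3.
change (size [:: n]) with 1 in ok3, sb3, v3.
split=> //; split=> //.
- by move=> i il; split; [rewrite sb3 // sb2 // v1|rewrite sb3 // v2|rewrite v3].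
- move=> i j il jl; rewrite sb3 // sb2 // sb1 // hl //.
Qed.

Lemma rounds_correct A : read_upto 0 A ->
  stmt_ok n B [:: n] A (SFor (EVar 0) round) /\
  read_upto n (sem [:: n] (SFor (EVar 0) round) A).
Proof.
move=> h0; pose it m := iteri m (fun i => sem (rcons [:: n] i) round) A.
have H m : m <= n -> read_upto m (it m).
  elim: m => [|m IH] mn //; have := IH (ltnW mn) => /(round_correct mn)[_].
  by [].
split; last exact: (H n (leqnn n)).
by split=> // i il; have := H i (ltnW il) => /(round_correct il)[].
Qed.

Hypothesis dollar_min : forall s : Ss, (dollar <= s)%O.

Lemma enum_rank_dollar (s : Ss) : (Order.enum_rank s == 0 :> nat) = (s == dollar).
Proof.
have d0 : Order.enum_rank dollar = 0 :> nat.
  have c0 : 0 < #|Ss| by apply/card_gt0P; exists dollar.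
  have := Order.le_enum_rank (@le_total _ Ss) dollar (Order.enum_val (Ordinal c0)).
  by rewrite dollar_min Order.enum_valK leEord leqn0 => /eqP.
by rewrite -d0 -(inj_eq (@Order.enum_rank_inj _ _)).
Qed.

Notation beg := (start T).

Lemma start_test i : i < n -> (ptag i == 0 :> nat) && (ssym i == 0) = (i == beg).
Proof.
move=> il; rewrite -(fcode_start n_gt0 size_T T_dollar il) /ptag /ssym.
by case: (fcode i) => [s|v] //=; rewrite enum_rank_dollar.
Qed.

Definition name (q : nat) : nat :=
  if nth (inl dollar) T q is inr c then Order.enum_rank (rename T c) else 0.

Lemma output_correct A : read_upto n A ->
  stmt_ok n B [:: n] A output /\
  forall q, q < n ->
    sem [:: n] output A fIn (2 * q) 0 = (if nth (inl dollar) T q is inr _ then 1 else 0) /\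
    sem [:: n] output A fIn (2 * q + 1) 0 =
      (if nth (inl dollar) T q is inl s then Order.enum_rank s : nat else name q).
Proof.
move=> h0; have hi := read_input h0.
have bl : beg < n := start_lt n_gt0 size_T.
have nev rho A' : evals (n :: rho) A' (EVar 0) n by [].
have cev rho A' c : c < 20 -> evals rho A' c c by move=> cl; apply: evals_cst; lia.
have bev : evals [:: n] A
 xstart beg.
  have S : \sum_(i < n) i * ((ptag i == 0 :> nat) && (ssym i == 0)) = beg.
    apply: (@sum_pick n id (fun i => (ptag i == 0 :> nat) && (ssym i == 0))) => //.
      by rewrite start_test.
    by move=> j jl; rewrite start_test // => /eqP.
  rewrite -S.
  apply: (@evals_sum _ _ _ _ _ _ n (fun i => i * ((ptag i == 0 :> nat) && (ssym i == 0)))) => //; last by rewrite S; lia.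
  move=> i il /=; apply: evals_mul => //; last first.
    by apply: (@leq_ltn_trans i); [case: (_ && _)|]; lia.
  apply: evals_and => //; apply: evals_eq; try exact: cev.
    exact: evals_tag.
  exact: evals_sym.
pose A1 := sem [:: n] (SStore fBeg 0 0 xstart) A.
have sb1 : same_but fBeg A A1.
  by move=> f i j /negPf hf; rewrite /A1 /= /set_cell hf.
have b1 : A1 fBeg 0 0 = beg by rewrite /A1; case: bev => _ <-.
have ok1 : stmt_ok n B [:: n] A (SStore fBeg 0 0 xstart).
  by case: bev => okb _; split=> //=; rewrite ?n_gt0 //; lia.
have h1 : read_upto n A1 by apply: (@read_upto_same 14) h0.
pose Q (A' : store) := forall q, q < n ->
    A' fIn (2 * q) 0 = (if nth (inl dollar) T q is inr _ then 1 else 0) /\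
    A' fIn (2 * q + 1) 0 =
      (if nth (inl dollar) T q is inl s then Order.enum_rank s : nat else name q).
apply: (@seq_correct n B [:: n] _ _ A Q ok1).
rewrite -/A1; move: A1 sb1 b1 h1 {ok1} => A1 _ b1 h1.
pose X q := A1 fRow beg q.
have Xc q : q < n -> codes (X q) (enc beg q) by move=> ql; apply: (read_row h1).
have Xle q : q < n -> X q <= 2 * n by move=> ql; exact: codes_le (Xc q ql).
have xev q (A' : store) f : f < 14 -> f != 13 -> q < n -> A' fBeg 0 0 = A1 fBeg 0 0 ->
    evals [:: n; q] A' (ECell f.+1 xbeg (EVar 1)) (A' f.+1 beg q).
  move=> fK f13 ql e; apply: evals_cell => //.
    by rewrite -b1 -e; apply: evals_cell; [exact: cev|exact: cev|rewrite /= n_gt0].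
  by rewrite /= bl ql fK.
(* A repeated symbol takes its name from an earlier position, hence the assumption on all positions
   below [m]. *)
have step m (A' : store) : m < n -> same_but fOut A1 A' ->
    (forall q, q < m -> A' fOut 0 q = name q) -> evals [:: n; m] A' xout (name m).
  move=> mn sb hv; have Xm := Xc m mn.
  have eX : evals [:: n; m] A' (ECell fRow xbeg (EVar 1)) (X m).
    by rewrite /X -(sb fRow) //; apply: xev => //; rewrite sb.
  have eZ : evals [:: n; m] A' (ECell fZer xbeg (EVar 1)) (zeros_upto beg m).
    by rewrite -(read_zeros h1) // -(sb fZer) //; apply: xev => //; rewrite sb.
  have back v : X m != 0 -> enc beg m = inr v ->
      [/\ X m <= m, X m <= n & name (m - X m) = name m].
    rewrite {2}/name => X0 E; have XE : X m = v by move: Xm; rewrite E.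
    have v0 : 0 < v by rewrite -XE lt0n.
    have [vm Te] := enc_back dollar n_gt0 size_T mn E v0.
    by rewrite XE /name Te; split=> //; lia.
  have new : X m = 0 -> 0 < zeros_upto beg m /\ zeros_upto beg m - 1 = name m.
    move=> X0; have E : enc beg m = inr 0.
      by move: Xm; case: (enc beg m) => [s [i _ []]|v] /=; rewrite X0 // => <-.
    have zp : 0 < zeros_upto beg m by rewrite /zeros_upto big_ord_recr /= E eqxx addn1.
    split=> //; rewrite /name; case Tm: (nth (inl dollar) T m) => [s|c].
      by have [_ /(_ Tm)] := enc_static dollar n_gt0 size_T s mn; rewrite E.
    by rewrite (rename_new n_gt0 size_T mn Tm E).
  apply: (@evalsE _ _ _ _ _ (if X m != 0 then
      (if n < X m then 0 else A' fOut 0 (m - X m)) else zeros_upto beg m - 1)); last first.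
    case: eqP => [/new[_ ->]|/eqP X0] //=.
    case E: (enc beg m) Xm => [s|v] Xm.
      case: Xm => i il [-> _]; rewrite ifT; last lia.
      by have [/(_ E)] := enc_static dollar n_gt0 size_T s mn; rewrite /name => ->.
    have [Xm1 Xm2 <-] := back v X0 E.
    by rewrite ltnNge Xm2 /= hv //; lia.
  apply: evals_if => // [X0|/new[zp _]].
    apply: evals_if_bool; first exact: evals_lt.
      by move=> _; apply: cev.
    rewrite -leqNgt => Xn; apply: evals_cell; first exact: cev.
      apply: evals_sub => //.
      case E: (enc beg m) Xm => [s|v] Xm; last by case: (back v X0 E).
      by case: Xm => i il [e _]; lia.
    by rewrite /= n_gt0; lia.
  by apply: evals_sub => //; exact: cev.
pose it m := iteri m (fun q => sem (rcons [:: n] q) (SStore fOut 0 (EVar 1) xout)) A1.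
have H m : m <= n -> same_but fOut A1 (it m) /\ forall q, q < m -> it m fOut 0 q = name q.
  elim: m => [|m IH] mn; first by split.
  have [sb hv] := IH (ltnW mn); have [_ es] := step m _ mn sb hv.
  have E f i j : it m.+1 f i j =
      if [&& f == fOut, i == 0 & j == m] then name m else it m f i j.
    by rewrite -es.
  split=> [f i j hf|q qm]; first by rewrite E (negPf hf) sb.
  by rewrite E !eqxx /=; case: eqP => [->|ne] //; apply: hv; lia.
have [sb2 v2] := H n (leqnn n).
have ok2 : stmt_ok n B [:: n] A1 (SFor (EVar 0) (SStore fOut 0 (EVar 1) xout)).
  split=> // i il; have [sbi hvi] := H i (ltnW il); have [oke _] := step i _ il sbi hvi.
  by split=> //=; rewrite ?n_gt0 ?il //; lia.
apply: (@seq_correct n B [:: n] _ _ A1 Q ok2).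
have -> : sem [:: n] (SFor (EVar 0) (SStore fOut 0 (EVar 1) xout)) A1 = it n by [].
move: (it n) sb2 v2 => A2 sb2 v2 {H it step}.
have q2ev q (A' : store) : q < n -> evals [:: n; q] A' (2%N * EVar 1)%X (2 * q).
  by move=> ql; apply: evals_mul => //; [exact: cev|lia].
have n1ev q (A' : store) : evals [:: n; q] A' (EVar 0 + 1%N)%X (n + 1).
  by apply: evals_add; [by []|exact: cev|lia].
have Xev q (A' : store) : q < n -> (forall f i j, f != fOut -> f != fIn -> A' f i j = A1 f i j) ->
    evals [:: n; q] A' (ECell fRow xbeg (EVar 1)) (X q).
  by move=> ql sb; rewrite /X -sb //; apply: xev => //; rewrite sb.
have inj0 : injective (muln 2) by move=> i j; lia.
have inj1 : injective (fun q => 2 * q + 1) by move=> i j; lia.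
have vld0 q : q < n -> cell_valid n fIn (2 * q) 0 by rewrite /=; lia.
have vld1 q : q < n -> cell_valid n fIn (2 * q + 1) 0 by rewrite /=; lia.
have q21ev q (A' : store) : q < n -> evals [:: n; q] A' (2%N * EVar 1 + 1%N)%X (2 * q + 1).
  by move=> ql; apply: evals_add; [exact: q2ev|exact: cev|lia].
have [ok3 sb3 v3 _] := @scatter_evals n B B_gt1 [:: n] fIn (EVar 0) (2%N * EVar 1)%X
  xtagout A2 n (muln 2) (fun q => X q < n + 1)
  isT isT inj0 (nev _ _) (leqnn n)
  (fun q ql => q2ev q A2 ql)
  (fun q ql => evals_lt (Xev q A2 ql (fun f i j h _ => sb2 f i j h)) (n1ev q A2))
  vld0.
apply: (@seq_correct n B [:: n] _ _ A2 Q ok3).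
move: (sem _ _ A2) sb3 v3 => A3 sb3 v3.
have sb3' f i j : f != fOut -> f != fIn -> A3 f i j = A1 f i j.
  by move=> h h'; rewrite sb3 // sb2.
have val q : q < n -> evals [:: n; q] A3 xvalout
    (if nth (inl dollar) T q is inl s then Order.enum_rank s : nat else name q).
  move=> ql; have Xq := Xc q ql.
  apply: (@evalsE _ _ _ _ _ (if n < X q then ssym (X q - (n + 1)) else A3 fOut 0 q)); last first.
    case E: (enc beg q) Xq => [s|v] Xq.
      have [/(_ E) -> _] := enc_static dollar n_gt0 size_T s ql.
      case: Xq => i il [-> e]; rewrite ifT; last lia.
      have -> : n.+1 + i - (n + 1) = i by lia.
      by rewrite /ssym e.
    rewrite Xq ifF; last by have := enc_le dollar size_T bl ql E; lia.
    rewrite sb3 // v2 //; case Tq: (nth _ T q) => [s|c] //.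
    by have [_ /(_ Tq)] := enc_static dollar n_gt0 size_T s ql; rewrite E.
  have eX := Xev q A3 ql sb3'.
  apply: evals_if_bool; first exact: evals_lt.
    move=> Xn; apply: evals_sym; last by have := Xle q ql; lia.
      by move=> i il; have [<- <- <-] := read_input h1 il; rewrite !sb3'.
    by apply: evals_sub => //; lia.
  by move=> _; apply: evals_cell => //; [exact: cev|rewrite /= n_gt0].
have [ok4 sb4 v4 o4] := @scatter_evals n B B_gt1 [:: n] fIn (EVar 0)
  (2%N * EVar 1 + 1%N)%X xvalout A3 n (fun q => 2 * q + 1)
  (fun q => if nth (inl dollar) T q is inl s then Order.enum_rank s : nat else name q)
  isT isT inj1 (nev _ _) (leqnn n) (fun q ql => q21ev q A3 ql) val vld1.
split=> //; rewrite /Q => q ql; split; last exact: v4.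
(* The values went to odd addresses, so the tags at even ones are still in place. *)
rewrite o4; last by move=> q' _; lia.
rewrite v3 //; have Xq := Xc q ql; case E: (enc beg q) Xq => [s|v] Xq.
  have [/(_ E) -> _] := enc_static dollar n_gt0 size_T s ql.
  by case: Xq => i il [-> _]; case: leqP => //; lia.
have := enc_le dollar size_T bl ql E; rewrite -Xq => Xl.
case Tq: (nth _ T q) => [s|c]; last by case: leqP => //; lia.
by have [_ /(_ Tq)] := enc_static dollar n_gt0 size_T s ql; rewrite E.
Qed.

Lemma inversion_correct A : holds_input A ->
  stmt_ok n B [:: n] A inversion /\
  forall q, q < n ->
    sem [:: n] inversion A fIn (2 * q) 0 = (if nth (inl dollar) T q is inr _ then 1 else 0) /\
    sem [:: n] inversion A fIn (2 * q + 1) 0 =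
      (if nth (inl dollar) T q is inl s then Order.enum_rank s : nat else name q).
Proof.
move=> /setup_correct[ok1 /rounds_correct[ok2 /output_correct[ok3 h]]].
by split=> //; split.
Qed.

End Correctness.

(** * Layout of input and output in memory, and the theorem *)

Section Words.
Variables (ds : Order.disp_t) (Ss : finOrderType ds) (A : Type) (code : A -> nat).
Implicit Types X : seq (Ss + A).

Lemma size_words X : size (words code X) = 2 * size X.
Proof.
elim: X => [|x X IH] //.
have -> : size (words code (x :: X)) = 2 + size (words code X) by case: x.
by rewrite IH /=; lia.
Qed.

Lemma nth_words x0 X q : q < size X ->
  nth 0 (words code X) (2 * q) = (if nth x0 X q is inr _ then 1 else 0) /\
  nth 0 (words code X) (2 * q + 1) =
    match nth x0 X q with inl s => Order.enum_rank s : nat | inr a => code a end.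
Proof.
elim: X q => [|x X IH] [|q] //; first by case: x.
move=> /IH[<- <-].
have E : words code (x :: X) =
    match x with inl s => [:: 0; Order.enum_rank s : nat] | inr a => [:: 1; code a] end
    ++ words code X by [].
have e1 : 2 * q.+1 = (2 * q).+2 by lia.
have e2 : 2 * q.+1 + 1 = (2 * q + 1).+2 by lia.
rewrite E e2 e1.
by case: x {E}.
Qed.

End Words.

Lemma halted_end P R M : halted P (State (0 + size P) R M).
Proof. by rewrite /halted add0n. Qed.

Theorem theorem1 :
  exists (P : seq instr) (C : nat),
  forall (ds dp : Order.disp_t) (Ss : finOrderType ds) (Sp : finOrderType dp)
    (dollar : Ss) (dollar_min : forall s : Ss, (dollar <= s)%O)
    (n : nat) (n_gt0 : 0 < n) (T : n.-tuple (psym Ss Sp))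
    (T_dollar : forall i : 'I_n, tnth T i = inl dollar <-> i.+1 = n)
    (L : seq (ecode Ss)) (L_pbwt : L = pbwt (inl dollar) T)
    (w : nat) (addressable : C * n ^ 2 <= 2 ^ w) (symbols_fit : #|Ss| <= 2 ^ w),
  runs_within w P (C * n ^ 3) (C * n ^ 2) (init L)
    (fun st => exists2 T' : seq (psym Ss Sp), pmatch T T' & outputs T' st).
Proof.
(* One variable is in scope, the input length in register 0. [stmt_time 1] pays for the time; as n
   >= 1, the extra 40 covers both the 2n + 14n^2 memory cells and the word bound 4n + 20. *)
exists (stmt_code 1 0 0 inversion), (stmt_time 1 inversion + 40).
move=> ds dp Ss Sp dollar dollar_min n n_gt0 T T_dollar L L_pbwt w.
have := stmt_time_poly inversion n_gt0; rewrite inversion_deg.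
move: (stmt_time 1 inversion) => t1 tle addressable symbols_fit.
have sT : size T = n := size_tuple T.
have Td q : q < n -> (nth (inl dollar) T q == inl dollar) = (q.+1 == n).
  move=> ql; have := T_dollar (Ordinal ql); rewrite (tnth_nth (inl dollar)) /=.
  by move=> h; apply/eqP/eqP => /h.
have nn : n ^ 2 = n * n by rewrite expnS expn1.
have n1 : n <= n * n by rewrite leq_pmulr.
have big : 40 * (n * n) <= (t1 + 40) * n ^ 2 by rewrite nn leq_mul2r leq_addl orbT.
have n_lt : n < 2 ^ w by lia.
have nf_lt : nfields < 2 ^ w by rewrite /nfields; lia.
have B_ge : 4 * n + 20 <= 2 ^ w by lia.
have cells : 2 * n + nfields * (n * n) <= (t1 + 40) * n ^ 2 by rewrite /nfields; lia.
have sL : size L = n by rewrite L_pbwt size_map (size_tau sT).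
have Lnth i : i < n -> nth (inr 0) L i =
    if lastc dollar T i is inl s then inl s else inr (zeros_upto T i (pivot dollar n T i)).
  by move=> il; rewrite L_pbwt (pbwt_nth dollar n_gt0 sT).
pose M := nth 0 (ewords L); pose A0 : store := fun f i j => M (addr n f i j).
have M_big a : 2 * n <= a -> M a = 0.
  by move=> h; rewrite /M nth_default // size_words sL.
have input i : i < n -> M (2 * i) = ptag dollar T i /\
     M (2 * i + 1) = if ptag dollar T i then pcnt dollar n T i else ssym dollar T i.
  move=> il; have := nth_words id (inr 0) (X := L) (q := i); rewrite sL => /(_ il)[w1 w2]; rewrite /M /ewords w1 w2.
  by rewrite Lnth // /ptag /pcnt /ssym /fcode; case: (lastc dollar T i).
(* A rank fits by [symbols_fit]; a count of zeros is at most the number of columns up to the pivot,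
   hence at most n. *)
have M_lt a : M a < 2 ^ w.
  case: (leqP (2 * n) a) => [/M_big->|al]; first by lia.
  have il : a %/ 2 < n by lia.
  have [h1 h2] := input _ il; have ad : a = 2 * (a %/ 2) \/ a = 2 * (a %/ 2) + 1 by lia.
  case: ad => ->; first by rewrite h1; case: (ptag _ _ _); lia.
  rewrite h2; case E: (ptag _ _ _).
    apply: leq_ltn_trans n_lt; move: E; rewrite /ptag /pcnt /fcode /pivot.
    have := lastc_in dollar n_gt0 sT (a %/ 2).
    case: (lastc _ _ _) => [s|p] //= li _.
    by apply: leq_trans (zeros_upto_le _ _ _) _; rewrite -[leqRHS](size_row sT (a %/ 2)) index_mem.
  rewrite /ssym; case: (fcode _ _ _) => [s|v]; last by lia.
  exact: leq_trans (ltn_ord _) symbols_fit.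
have hA : store_rel w n A0 M by move=> f i j hv; split=> //; exact: M_lt.
have hin : holds_input dollar n T A0.
  split=> [i il|i j il jl]; first exact: input.
  by rewrite /A0 /addr M_big //; lia.
have [ok res] := inversion_correct n_gt0 sT Td B_ge dollar_min hin.
pose R r := if r == 0 then size L else 0.
have hr : env_rel w n [:: n] R.
  by split=> // [[|x]|[|x]] //=; rewrite /R /= sL.
have hc : code_at (stmt_code 1 0 0 inversion) 0 (stmt_code (size [:: n]) 0 0 inversion) by [].
have [t [R' [M' [tl [rn acc] [hA' _]]]]] :=
  stmt_code_correct n_lt nf_lt addressable cells hc hA hr ok.
exists t; split.
- apply: leq_trans tl (leq_trans tle _).
  by rewrite leq_mul2r leq_addr orbT.
- by rewrite rn; exact: halted_end.
- exact: acc.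
rewrite rn; exists [seq psubst (rename T) c | c <- T].
  by exists (rename T) => //; exact: (rename_bij n_gt0 sT).
rewrite /outputs /pwords size_words size_map sT /=.
apply: (@eq_from_nth _ 0); first by rewrite size_mkseq size_words size_map sT.
move=> a; rewrite size_mkseq => al; rewrite nth_mkseq //.
have il : a %/ 2 < n by lia.
have := nth_words (fun p : Sp => Order.enum_rank p : nat) (inl dollar)
          (X := [seq psubst (rename T) c | c <- T]) (q := a %/ 2).
rewrite size_map sT => /(_ il).
rewrite (nth_map (inl dollar)) ?sT // => -[w1 w2].
have [o1 o2] := res _ il.
have ad : a = 2 * (a %/ 2) \/ a = 2 * (a %/ 2) + 1 by lia.
case: ad => ->.
  rewrite w1; have [|e _] := hA' 0 (2 * (a %/ 2)) 0; first by rewrite /=; lia.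
  by rewrite [LHS]e o1; case: (nth _ T _).
rewrite w2; have [|e _] := hA' 0 (2 * (a %/ 2) + 1) 0; first by rewrite /=; lia.
by rewrite [LHS]e o2 /name; case: (nth _ T _).
Qed.
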